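(* Let $U:\mathbb R\to\mathbb R$ be continuously differentiable and $\lambda_{\mathrm{refr}}:\mathbb R\to[0,\infty)$ continuous, and let $(L,\mathcal D(L))$ be the associated zigzag operator on $L^2(\mu)$. Define the operator $(L^\times,\mathcal D(L^\times))$ by $$L^\times g(x,\theta)=-\theta\,\partial_xg(x,\theta)+\lambda(x,-\theta)\,(g(x,-\theta)-g(x,\theta)),$$ with domain $\mathcal D(L^\times)$ equal to the set of all $g\in L^2(\mu)\cap W^{1,2}_{\mathrm{loc}}(E)$ for which the function $(x,\theta)\mapsto-\theta\,\partial_xg(x,\theta)+\lambda(x,-\theta)(g(x,-\theta)-g(x,\theta))$ belongs to $L^2(\mu)$. Then the Hilbert space adjoint of $L$ satisfies $(L^\star,\mathcal D(L^\star))=(L^\times,\mathcal D(L^\times))$.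
   Context: $E=\mathbb R\times\{-1,+1\}$; for $f:E\to\mathbb C$ write $f^{\pm}(x)=f(x,\pm1)$. $\lambda(x,\theta)=\max(\theta U'(x),0)+\lambda_{\mathrm{refr}}(x)$ for $(x,\theta)\in E$. The measure $\nu$ on $\mathbb R$ is $\nu(dx)=e^{-U(x)}dx$ and $\mu$ on $E$ is $\mu(A\times\{\theta\})=\nu(A)$ (not necessarily finite). $L^2(\mu)$ is the complex Hilbert space with $\langle f,g\rangle=\sum_{\theta=\pm1}\int_{\mathbb R}f(x,\theta)\overline{g(x,\theta)}e^{-U(x)}dx$. $W^{1,2}_{\mathrm{loc}}(E)$ is the set of $f$ with $f^{\pm}\in W^{1,2}_{\mathrm{loc}}(\mathbb R)$. The operator $L$ is $Lf(x,\theta)=\theta\,\partial_xf(x,\theta)+\lambda(x,\theta)(f(x,-\theta)-f(x,\theta))$ with domain $\mathcal D(L)=\{f\in L^2(\mu)\cap W^{1,2}_{\mathrm{loc}}(E): Lf\in L^2(\mu)\}$. The adjoint has domain $\mathcal D(L^\star)=\{g\in L^2(\mu):\exists h\in L^2(\mu)\ \langle Lf,g\rangle=\langle f,h\rangle\ \forall f\in\mathcal D(L)\}$ and $L^\star g=h$. *)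

(* Defs.v *)
From HB Require Import structures.
From mathcomp Require Import all_boot all_order all_algebra.
From mathcomp Require Import complex.
From mathcomp Require Import all_classical all_reals all_analysis.
From mathcomp Require Import measurable_realfun.

Set Implicit Arguments.
Unset Strict Implicit.
Unset Printing Implicit Defensive.
Import Order.TTheory GRing.Theory Num.Theory.
Import numFieldNormedType.Exports.

Local Open Scope classical_set_scope.
Local Open Scope ring_scope.
Local Open Scope complex_scope.

Section ComplexFunctions.
Context {R : realType}.

(* R[i] carries no sigma-algebra and no integral in the library: both are taken
   on real and imaginary parts. *)
Definition cmeasurable d (T : measurableType d) (f : T -> R[i]) : Prop :=
  measurable_fun setT (fun x => complex.Re (f x)) /\
  measurable_fun setT (fun x => complex.Im (f x)).

Definition cintegral (f : R -> R[i]) : R[i] :=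
  (\int[lebesgue_measure]_x complex.Re (f x)) +i*
  (\int[lebesgue_measure]_x complex.Im (f x)).

Definition L2loc (f : R -> R[i]) : Prop :=
  cmeasurable f /\
  forall K : set R, compact K ->
    (\int[lebesgue_measure]_(x in K) (Normc.normc (f x) ^+ 2)%:E < +oo)%E.

(* Real-valued C_c^oo functions; by linearity they give the same weak
   derivatives as complex-valued ones. *)
Definition test_function (phi : R -> R) : Prop :=
  (forall n x, derivable (derive1n n phi) x 1) /\
  compact (closure [set x | phi x != 0]).

Definition is_weak_derivative (f g : R -> R[i]) : Prop :=
  forall phi, test_function phi ->
    cintegral (fun x => f x * (derive1 phi x)%:C) =
    - cintegral (fun x => g x * (phi x)%:C).

Definition W12loc (f : R -> R[i]) : Prop :=
  L2loc f /\ exists2 g, L2loc g & is_weak_derivative f g.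

(* A representative of the weak derivative, which is unique up to a Lebesgue
   null set; 0 if there is none in L^2_loc. *)
Definition weak_derivative (f : R -> R[i]) : R -> R[i] :=
  xget (fun=> 0) [set g | L2loc g /\ is_weak_derivative f g].

End ComplexFunctions.

(* The component theta in {-1, +1} is encoded by a boolean, true standing for
   +1, so that - theta is ~~ theta. *)
Definition E (R : realType) : Type := (R * bool)%type.

Definition theta_val {R : realType} (theta : bool) : R :=
  if theta then 1 else -1.

Section WeightedL2.
Context {R : realType} (U : R -> R).

Definition nu (A : set R) : \bar R :=
  (\int[lebesgue_measure]_(x in A) (expR (- U x))%:E)%E.

Definition mu (B : set (R * bool)) : \bar R :=
  (\sum_(theta : bool) nu [set x | B (x, theta)])%E.

Lemma mu_slice (A : set R) (theta : bool) : mu (A `*` [set theta]) = nu A.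
Proof.
rewrite /mu (bigD1 theta)//= big1 ?adde0; last first.
  move=> t /negP tN; rewrite (_ : [set x | _] = set0) ?/nu ?integral_set0//.
  by apply/seteqP; split=> // x [_ /= tE]; apply: tN; apply/eqP.
by congr (nu _); apply/seteqP; split=> [x []//|x Ax]; split.
Qed.

(* nu and mu are plain set functions, since being a measure requires U to be
   measurable. *)
Lemma nu_semi_sigma_additive : measurable_fun setT U -> semi_sigma_additive nu.
Proof.
move=> mU F mF tF mUF.
have mf : measurable_fun setT ((fun x => (expR (- U x))%:E) : R -> \bar R).
  apply/measurable_EFinP; apply: measurableT_comp => //.
  exact: measurableT_comp.
rewrite /nu; apply: cvg_toP.
  apply: ereal_nondecreasing_is_cvgn => m n mn.
  apply: lee_sum_nneg_natr => // k _ _; apply: integral_ge0 => /= x Fkx.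
  by rewrite lee_fin expR_ge0.
rewrite ge0_integral_bigcup//=.
exact: (measurable_funS measurableT (@subsetT _ _) mf).
Qed.

Lemma mu_semi_sigma_additive : measurable_fun setT U -> semi_sigma_additive mu.
Proof.
move=> mU F mF tF mUF.
have nu_ge0 A : (0 <= nu A)%E.
  by apply: integral_ge0 => x _; rewrite lee_fin expR_ge0.
have slice theta :
    (fun n => \sum_(0 <= i < n) nu [set x | F i (x, theta)])%E @ \oo -->
    nu [set x | (\bigcup_i F i) (x, theta)].
  have mpair : measurable_fun setT (fun x : R => (x, theta)).
    exact: pair2_measurable.
  rewrite (_ : [set x | _] = \bigcup_i [set x | F i (x, theta)])//.
  have mS i : measurable [set x | F i (x, theta)].
    by rewrite -[X in measurable X]setTI; exact: mpair.
  apply: nu_semi_sigma_additive => //; last exact: bigcupT_measurable.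
  apply/trivIsetP => i j _ _ ij; apply/seteqP; split=> // x [/= Fi Fj].
  by move/trivIsetP : tF => /(_ i j I I ij) /seteqP[/(_ (x, theta))] + _; apply.
rewrite /mu [X in _ --> X]big_bool/=.
rewrite [X in X @ \oo](_ : _ = (fun n =>
    \sum_(0 <= i < n) nu [set x | F i (x, true)] +
    \sum_(0 <= i < n) nu [set x | F i (x, false)])%E); last first.
  by apply/funext => n; rewrite -big_split; apply: eq_bigr => i _; rewrite big_bool.
by apply: cvgeD; [rewrite ge0_adde_def// inE; exact: nu_ge0|exact: slice|exact: slice].
Qed.

(* Elements of L^2(mu) are handled through representatives; equality of
   classes is almost everywhere equality for mu. *)
Definition L2 (f : E R -> R[i]) : Prop :=
  @cmeasurable R _ (R * bool)%type f /\
  (\int[mu]_e (Normc.normc (f e) ^+ 2)%:E < +oo)%E.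

Definition L2_eq (f g : E R -> R[i]) : Prop :=
  \forall e \ae mu, f e = g e.

Definition inner (f g : E R -> R[i]) : R[i] :=
  \sum_(theta : bool)
    cintegral (fun x => f (x, theta) * (g (x, theta))^* * (expR (- U x))%:C).

Record operator := Operator {
  dom : set (E R -> R[i]) ;
  app : (E R -> R[i]) -> (E R -> R[i])
}.

(* The graph of T in L^2(mu) x L^2(mu). *)
Definition graph (T : operator) (f h : E R -> R[i]) : Prop :=
  [/\ dom T f, L2 h & L2_eq (app T f) h].

(* h is a value at g of the Hilbert space adjoint of T. *)
Definition adjoint_graph (T : operator) (g h : E R -> R[i]) : Prop :=
  [/\ L2 g, L2 h & forall f, dom T f -> inner (app T f) g = inner f h].

Definition adjoint_dom (T : operator) : set (E R -> R[i]) :=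
  [set g | exists h, adjoint_graph T g h].

End WeightedL2.

Section Zigzag.
Context {R : realType}.

Definition W12loc_E (f : E R -> R[i]) : Prop :=
  forall theta : bool, W12loc (fun x => f (x, theta)).

Definition partial_x (f : E R -> R[i]) : E R -> R[i] :=
  fun '(x, theta) => weak_derivative (fun y => f (y, theta)) x.

Context (U lref : R -> R).

Definition rate (x : R) (theta : bool) : R :=
  Num.max (theta_val theta * derive1 U x) 0 + lref x.

Definition zigzag_formula (f : E R -> R[i]) : E R -> R[i] :=
  fun '(x, theta) =>
    (theta_val theta)%:C * partial_x f (x, theta)
    + (rate x theta)%:C * (f (x, ~~ theta) - f (x, theta)).

Definition zigzag : operator :=
  Operator [set f | [/\ L2 U f, W12loc_E f & L2 U (zigzag_formula f)]] zigzag_formula.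

Definition zigzag_times_formula (g : E R -> R[i]) : E R -> R[i] :=
  fun '(x, theta) =>
    - (theta_val theta)%:C * partial_x g (x, theta)
    + (rate x (~~ theta))%:C * (g (x, ~~ theta) - g (x, theta)).

Definition zigzag_times : operator :=
  Operator [set g | [/\ L2 U g, W12loc_E g & L2 U (zigzag_times_formula g)]] zigzag_times_formula.

End Zigzag.

(* Main.v *)
Require Import Defs.
From HB Require Import structures.
From mathcomp Require Import all_boot all_order all_algebra.
From mathcomp Require Import complex.
From mathcomp Require Import all_classical all_reals all_analysis.
From mathcomp Require Import measurable_realfun.
From mathcomp Require Import ring lra.
Set Implicit Arguments.
Unset Strict Implicit.
Unset Printing Implicit Defensive.
Import Order.TTheory GRing.Theory Num.Theory.
Import numFieldNormedType.Exports.
Local Open Scope classical_set_scope.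
Local Open Scope ring_scope.

(* For f in D(L) and g in D(L^x), P = sum_theta theta f conj(g) e^-U has weak
   derivative sum_theta (Lf conj(g) - f conj(L^x g)) e^-U: the cross terms
   cancel, and the diagonal ones are absorbed by the derivative of e^-U because
   lambda(x, 1) - lambda(x, -1) = U'(x). Both P and its derivative are
   integrable over the line, so the integral of the latter vanishes, i.e. L^x is
   contained in the adjoint of L. Conversely, testing <Lf, g> = <f, h> against
   smooth compactly supported f that live on one copy of the line shows that
   conj(g) e^-U has a weak derivative in L^2_loc; multiplying by e^U, so does g,
   and the resulting equation is L^x g = h.

   The product rule for weak derivatives comes from integration by parts for
   primitives of locally integrable functions (Fubini), once a function with a
   weak derivative is known to be almost everywhere a primitive of it. The latter
   is read off at Lebesgue points, with test functions that approximate the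
   indicator of an interval. *)

(** Two obstacles shape the argument. First, [U] is only of class C^1, so [exp (U) * phi] need not
    be a test function when [phi] is one: the weight has to stay with the unknown, in conj(g) e^-U,
    and can be divided out only afterwards, by the product rule. Second, elements of D(L) carry no
    decay at infinity. Integrability replaces it: a product of two functions of L^2(mu) is
    integrable against the weight, and cutoffs with derivative [O(1 / n)] ask no more of the flux. A
    test function placed on one copy of the line is seen by [L] on both copies, through the jump
    term, but its derivative occurs on that copy only. This isolates the weak derivative of a single
    component of the unknown. Since [weak_derivative] is a chosen representative, identities that
    involve it hold almost everywhere only, and each passage to L^2(mu) or to an inner product goes
    through an almost everywhere equality. *)

(** * Smooth step functions *)

Section SmoothStep.
Context {R : realType}.
Implicit Types (p : {poly R}) (f g F : R -> R).

(* [t ^+ k] is dominated by [k`! * exp t], whence a polynomial in [x^-1] times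
   [exp (- x^-1)] is [O(x ^+ 2)] as [x] decreases to [0]. *)
Definition flat_exp p (x : R) : R :=
  if 0 < x then p.[x^-1] * expR (- x^-1) else 0.

Lemma expRN_Xn_le (k : nat) (t : R) : 0 <= t -> t ^+ k * expR (- t) <= k`!%:R.
Proof.
move=> t0; rewrite expRN ler_pdivrMr ?expR_gt0//.
case: k => [|k]; first by rewrite expr0 fact0 mul1r -expR0 ler_expR.
rewrite mulrC -ler_pdivrMr ?ltr0n ?fact_gt0//.
by rewrite (le_trans _ (expR_ge1Dxn k t0))// lerDr.
Qed.

Lemma horner_expRN_bounded p :
  exists C : R, forall t : R, 0 <= t -> `|p.[t] * expR (- t)| <= C.
Proof.
exists (\sum_(i < size p) `|p`_i| * i`!%:R) => t t0.
rewrite horner_coef mulr_suml (le_trans (ler_norm_sum _ _ _))//.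
apply: ler_sum => i _; rewrite -mulrA normrM ler_wpM2l//.
by rewrite ger0_norm ?expRN_Xn_le// mulr_ge0 ?exprn_ge0 ?expR_ge0.
Qed.

(** With [t = x^-1], the chain rule turns [p(t) * exp (- t)] into
    [t ^+ 2 * (p(t) - p'(t)) * exp (- t)], again of the same form. Carrying an arbitrary polynomial
    thus makes the family closed under differentiation. *)
Lemma is_derive_flat_exp p (x : R) :
  is_derive x (1 : R) (flat_exp p) (flat_exp ('X^2 * (p - p^`())) x).
Proof.
have [x0|x0|->] := ltgtP x 0.
- rewrite {2}/flat_exp ltNge ltW//=.
  apply: (@near_eq_is_derive _ _ _ (cst 0)).
  near=> y; rewrite /flat_exp ltNge ltW//; near: y; exact: lt_nbhsl.
- rewrite {2}/flat_exp x0.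
  have x_neq0 : x != 0 by rewrite gt_eqF.
  have dV : is_derive x 1 (fun y : R => y^-1) (- x ^- 2).
    by apply: is_derive_eq; [exact: is_deriveV|rewrite scaler1].
  have dp : is_derive x 1 (fun y : R => p.[y^-1]) (p^`().[x^-1] * (- x ^- 2)).
    exact: (is_derive1_comp (f := horner p) (g := fun y : R => y^-1)).
  have de : is_derive x 1 (fun y : R => expR (- y^-1))
      (expR (- x^-1) * (- (- x ^- 2))).
    exact: (is_derive1_comp (f := expR) (g := fun y : R => - y^-1)).
  have E : \near x, p.[x^-1] * expR (- x^-1) = flat_exp p x.
    by near=> y; rewrite /flat_exp ifT//; near: y; exact: lt_nbhsr.
  apply: (near_eq_is_derive E); apply: is_derive_eq (is_deriveM dp de) _.
  rewrite !hornerE /GRing.scale/= -exprVn; ring.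
- rewrite {2}/flat_exp ltxx.
  (* The extra factor ['X^2] yields the bound [C * y ^+ 2], so that the difference quotient at [0]
     is [O(h)]. *)
  have [C hC] := horner_expRN_bounded ('X^2 * p).
  have flat_le y : `|flat_exp p y| <= C * y ^+ 2.
    rewrite /flat_exp; case: ifPn => y0; last first.
      rewrite normr0 mulr_ge0 ?sqr_ge0//.
      by apply: le_trans (hC 0 _) => //.
    have yV0 : 0 <= y^-1 by rewrite invr_ge0 ltW.
    have := hC _ yV0.
    rewrite hornerM hornerXn -mulrA normrM ger0_norm ?exprn_ge0//.
    by rewrite exprVn ler_pdivrMl ?exprn_gt0// [C * _]mulrC.
  have C0 : 0 <= C by apply: le_trans (hC 0 _).
  have lim0 : h^-1 *: (flat_exp p (h *: 1 + 0) - flat_exp p 0) @[h --> 0^'] --> (0 : R).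
    apply/cvgr0Pnorm_le => e e0.
    near=> h.
    have h0 : h != 0 by near: h; exact: nbhs_dnbhs_neq.
    have -> : flat_exp p 0 = 0 by rewrite /flat_exp ltxx.
    rewrite subr0 addr0 /GRing.scale/= mulr1 normrM.
    apply: (@le_trans _ _ (`|h^-1| * (C * h ^+ 2))).
      by rewrite ler_wpM2l.
    rewrite -real_normK ?num_real// normfV mulrCA expr2 mulKf ?normr_eq0//.
    (* [C] may be zero; [C + 1] is positive and can be divided by. *)
    apply: (@le_trans _ _ ((C + 1) * `|h|)); first by rewrite ler_wpM2r// lerDl.
    rewrite mulrC -ler_pdivlMr ?ltr_wpDl//.
    near: h; apply: dnbhs0_le; by rewrite divr_gt0// ltr_wpDl.
  apply: DeriveDef; last by apply/cvg_lim.
  by apply/cvg_ex; exists 0.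
Unshelve. all: by end_near. Qed.

End SmoothStep.

(** * Functions supported in a set, almost everywhere reasoning *)

Section Support.
Context d (T : measurableType d) (R : realType).
Variable (m : {measure set T -> \bar R}).

Lemma restrict_support (D : set T) (f : T -> R) :
  (forall x, ~ D x -> f x = 0) -> f \_ D = f.
Proof.
move=> f0; apply/funext => x; rewrite patchE; case: ifPn => //.
by rewrite notin_setE => /f0.
Qed.

Lemma integrable_restrictT (D : set T) (f : T -> R) : measurable D ->
  m.-integrable D (EFin \o f) -> m.-integrable setT (EFin \o (f \_ D)).
Proof.
by move=> mD; rewrite -restrict_EFin; move/(integrable_mkcond (EFin \o f) mD).
Qed.

Lemma integrable_support (D : set T) (f : T -> R) : measurable D ->
  m.-integrable D (EFin \o f) -> (forall x, ~ D x -> f x = 0) ->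
  m.-integrable setT (EFin \o f).
Proof.
by move=> mD fD f0; rewrite -(restrict_support f0); exact: integrable_restrictT.
Qed.

End Support.

Lemma integrable_scale d (T : measurableType d) (R : realType)
    (m : {measure set T -> \bar R}) (D : set T) (f : T -> R) c :
  measurable D -> m.-integrable D (EFin \o f) ->
  m.-integrable D (EFin \o (fun x => c * f x)).
Proof. by move=> mD fD; have := integrableZl mD c fD; apply: eq_integrable. Qed.

Section AlmostEverywhere.
Context {R : realType}.
Local Notation leb := (@lebesgue_measure R).

Lemma ae_mono (P Q : R -> Prop) : (forall x, P x -> Q x) ->
  (\forall x \ae leb, P x) -> \forall x \ae leb, Q x.
Proof. by move=> PQ; apply: filterS => //; exact: (ae_filter_ringOfSetsType leb). Qed.

Lemma ae_mono2 (P Q S : R -> Prop) : (forall x, P x -> Q x -> S x) ->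
  (\forall x \ae leb, P x) -> (\forall x \ae leb, Q x) -> \forall x \ae leb, S x.
Proof. by move=> PQ; apply: filterS2 => //; exact: (ae_filter_ringOfSetsType leb). Qed.

End AlmostEverywhere.

Section Smooth.
Context {R : realType}.
Implicit Types (f g F : R -> R).
Local Notation leb := (@lebesgue_measure R).

Definition smooth f := forall n (x : R), derivable (derive1n n f) x 1.

(* A class of functions closed under differentiation consists of smooth
   functions. *)
Inductive smooth_gen : (R -> R) -> Prop :=
| smooth_gen_flat_exp p : smooth_gen (flat_exp p)
| smooth_gen_cst c : smooth_gen (cst c)
| smooth_genD f g : smooth_gen f -> smooth_gen g -> smooth_gen (fun x => f x + g x)
| smooth_genM f g : smooth_gen f -> smooth_gen g -> smooth_gen (fun x => f x * g x)
| smooth_gen_affine a b f : smooth_gen f -> smooth_gen (fun x => f (a * x + b))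
| smooth_gen_antiderivative F f :
    (forall x : R, is_derive x (1 : R) F (f x)) -> smooth_gen f -> smooth_gen F.

Lemma is_derive_affine (a b x : R) : is_derive x (1 : R) (fun y => a * y + b) a.
Proof.
by apply: is_derive_eq; rewrite addr0 /GRing.scale/= mulr1.
Qed.

Lemma smooth_gen_derive f : smooth_gen f ->
  exists2 g, smooth_gen g & forall x : R, is_derive x (1 : R) f (g x).
Proof.
elim=> {f}.
- move=> p; exists (flat_exp ('X^2 * (p - p^`()))).
    exact: smooth_gen_flat_exp.
  exact: is_derive_flat_exp.
- by move=> c; exists (cst 0) => [|x]; [exact: smooth_gen_cst|exact: is_derive_cst].
- move=> f g _ [f' sf' df] _ [g' sg' dg].
  exists (fun x => f' x + g' x) => [|x]; first exact: smooth_genD.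
  exact: is_deriveD.
- move=> f g sf [f' sf' df] sg [g' sg' dg].
  exists (fun x => f x * g' x + g x * f' x) => [|x].
    by apply: smooth_genD; exact: smooth_genM.
  exact: is_deriveM.
- move=> a b f sf [f' sf' df].
  exists (fun x => f' (a * x + b) * a) => [|x].
    by apply: (smooth_genM (smooth_gen_affine a b sf')); exact: smooth_gen_cst.
  exact: (is_derive1_comp (df _) (is_derive_affine a b x)).
- by move=> F f df sf _; exists f.
Qed.

Lemma smooth_gen_smooth f : smooth_gen f -> smooth f.
Proof.
move=> sf n; suff: smooth_gen (derive1n n f).
  by move=> /smooth_gen_derive[g _ dg] x; case: (dg x).
elim: n => // n /smooth_gen_derive[g sg dg].
rewrite derive1nS (_ : (_)^`()%classic = g)//.
by apply/funext => x; rewrite derive1E; case: (dg x).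
Qed.

Lemma smooth_derivable f : smooth f -> forall x : R, derivable f x 1.
Proof. by move=> sf x; exact: sf 0%N x. Qed.

Lemma smooth_continuous f : smooth f -> continuous f.
Proof.
by move=> sf x; apply/differentiable_continuous/derivable1_diffP/smooth_derivable.
Qed.

Lemma derivable_continuous f : (forall x : R, derivable f x 1) -> continuous f.
Proof. by move=> df x; apply/differentiable_continuous/derivable1_diffP. Qed.

(** [S] is the normalized integral of the bump [b], which is positive exactly on []0, 1[]. It has no
    closed form, whence the constructor [smooth_gen_antiderivative]. Rescaled copies of [S] serve as
    smooth indicators and cutoffs, rescaled copies of [s] as approximations of the identity. *)
Lemma smooth_step : exists S s : R -> R, exists M : R,
  [/\ [/\ smooth_gen S, smooth_gen s & forall x : R, is_derive x (1 : R) S (s x)],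
      forall x, x <= 0 -> S x = 0 /\ s x = 0,
      forall x, 1 <= x -> S x = 1 /\ s x = 0,
      forall x, 0 <= S x <= 1 &
      forall x, `|s x| <= M].
Proof.
pose b (x : R) := flat_exp 1 x * flat_exp 1 (-1 * x + 1).
have sb : smooth_gen b.
  apply: smooth_genM; first exact: smooth_gen_flat_exp.
  by apply: smooth_gen_affine; exact: smooth_gen_flat_exp.
have cb : continuous b by apply: smooth_continuous; exact: smooth_gen_smooth.
have f_ge0 (x : R) : 0 <= flat_exp 1 x.
  by rewrite /flat_exp; case: ifPn => // _; rewrite hornerC mul1r expR_ge0.
have f_le1 (x : R) : flat_exp 1 x <= 1.
  rewrite /flat_exp; case: ifPn => // x0; rewrite hornerC mul1r -expR0 ler_expR.
  by rewrite oppr_le0 invr_ge0 ltW.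
have f_le0 (x : R) : x <= 0 -> flat_exp 1 x = 0.
  by rewrite /flat_exp leNgt => /negbTE ->.
have f_gt0 (x : R) : 0 < x -> 0 < flat_exp 1 x.
  by rewrite /flat_exp => ->; rewrite hornerC mul1r expR_gt0.
have b_ge0 x : 0 <= b x by rewrite mulr_ge0.
have b_le1 x : b x <= 1 by rewrite -(mulr1 1) ler_pM.
have b_le0 x : x <= 0 -> b x = 0 by move=> x0; rewrite /b f_le0 ?mul0r.
have b_ge1 x : 1 <= x -> b x = 0.
  by move=> x1; rewrite /b [X in _ * X]f_le0 ?mulr0//; lra.
have b_gt0 x : 0 < x < 1 -> 0 < b x.
  by move=> x01; rewrite /b mulr_gt0// f_gt0//; lra.
have ib : leb.-integrable setT (EFin \o b).
  have : leb.-integrable `[0, 1] (EFin \o b).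
    apply: continuous_compact_integrable; first exact: segment_compact.
    exact: continuous_subspaceT.
  move=> /integrable_support; apply => // x.
  rewrite /= in_itv/= => /negP; rewrite negb_and -!ltNge => /orP[] x01.
  - by rewrite b_le0// ltW.
  - by rewrite b_ge1// ltW.
pose F x := \int[leb]_(t in `]-oo, x]) b t.
have ibS A : measurable A -> leb.-integrable A (EFin \o b).
  by move=> mA; exact: integrableS ib.
have dF (x : R) : is_derive x (1 : R) F (b x).
  have x1 : x < x + 1 by rewrite ltrDl.
  have ix : leb.-integrable `]-oo, x + 1] (EFin \o b) by exact: ibS.
  have [dF F'] := continuous_FTC1 x1 ix (ltNyr x) (cb x).
  by apply: DeriveDef; [exact: dF|rewrite -derive1E].
have F_le0 x : x <= 0 -> F x = 0.
  move=> x0; rewrite /F (@eq_Rintegral _ _ _ _ _ (cst 0)) ?Rintegral_cst ?mul0r//.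
  move=> t; rewrite inE/= in_itv/= => tx; rewrite b_le0//; lra.
have cF : continuous F by apply: derivable_continuous => x; case: (dF x).
have mvt x y : x < y -> exists2 c, c \in `]x, y[ & F y - F x = b c * (y - x).
  by move=> xy; apply: MVT => //; exact: continuous_subspaceT.
have ndF x y : x <= y -> F x <= F y.
  rewrite le_eqVlt => /predU1P[->//|xy]; have [c _] := mvt _ _ xy.
  by rewrite -subr_ge0 => ->; rewrite mulr_ge0// subr_ge0 ltW.
(* The mean value theorem on [[0, 1]] exhibits [F 1] as a value of [b] inside []0, 1[]. *)
have F01 : 0 < F 1.
  have [c] := mvt _ _ (@ltr01 R).
  by rewrite in_itv/= (F_le0 0)// !subr0 mulr1 => /b_gt0 c0 ->.
have F_ge1 x : 1 <= x -> F x = F 1.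
  rewrite le_eqVlt => /predU1P[->//|x1]; have [c] := mvt _ _ x1.
  rewrite in_itv/= => /andP[c1 _]; rewrite b_ge1 ?ltW// mul0r => /eqP.
  by rewrite subr_eq0 => /eqP.
have F_ge0 x : 0 <= F x.
  by have [x0|/ltW x0] := leP x 0; [rewrite F_le0|rewrite -(F_le0 0)// ndF].
have FV0 : 0 <= (F 1)^-1 by rewrite invr_ge0 ltW.
(* The bound on the derivative is [(F 1)^-1] because [b <= 1]. *)
exists (fun x => (F 1)^-1 * F x), (fun x => (F 1)^-1 * b x), (F 1)^-1.
have dS (x : R) : is_derive x (1 : R) (fun x => (F 1)^-1 * F x) ((F 1)^-1 * b x).
  exact: is_deriveZ.
have ss : smooth_gen (fun x => (F 1)^-1 * b x).
  by apply: smooth_genM => //; exact: smooth_gen_cst.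
split => [|x x0|x x1|x|x].
- by split => //; exact: (smooth_gen_antiderivative dS).
- by rewrite (F_le0 _ x0) (b_le0 _ x0) mulr0.
- by rewrite (F_ge1 _ x1) (b_ge1 _ x1) mulr0 mulVf// gt_eqF.
- rewrite mulr_ge0//= mulrC ler_pdivrMr// mul1r.
  by have [x1|/ltW x1] := leP x 1; [rewrite ndF|rewrite F_ge1].
- by rewrite ger0_norm ?mulr_ge0// -[leRHS]mulr1 ler_wpM2l.
Qed.

End Smooth.

(** * Locally integrable functions *)

Section LocallyIntegrable.
Context {R : realType}.
Implicit Types (f g u v : R -> R) (K D : set R).
Local Notation leb := (@lebesgue_measure R).
Local Notation L1loc := (locally_integrable [set: R]).

Lemma integrable_dominated D f g : measurable D -> measurable_fun D f ->
  (forall x, D x -> `|f x| <= g x) -> leb.-integrable D (EFin \o g) ->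
  leb.-integrable D (EFin \o f).
Proof.
move=> mD mf fg; apply: le_integrable => //; first exact/measurable_EFinP.
by move=> x Dx; rewrite lee_fin (le_trans (fg x Dx))// ler_norm.
Qed.

Lemma L1loc_measurable f : L1loc f -> measurable_fun setT f.
Proof. by case. Qed.

Lemma L1loc_integrable f K : L1loc f -> compact K -> leb.-integrable K (EFin \o f).
Proof.
move=> [mf _ fK] cK; apply/integrableP; split; last exact: fK.
by apply/measurable_EFinP; apply: measurable_funTS.
Qed.

Lemma L1locP f : measurable_fun setT f ->
  (forall a b, leb.-integrable `[a, b] (EFin \o f)) -> L1loc f.
Proof.
move=> mf fab; split => //; first exact: openT.
(* [compact_bounded] bounds [K] by every number strictly above [M], hence [M + 1]. *)
move=> K _ cK; have [M [_ KM]] := compact_bounded cK.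
have /integrableP[_] := fab (- (M + 1)) (M + 1); apply: le_lt_trans.
apply: ge0_subset_integral => //=; first exact: compact_measurable.
  by apply/measurable_EFinP; apply: measurableT_comp => //; apply: measurable_funTS.
by move=> x Kx; rewrite /= in_itv/= -ler_norml; apply: KM => //; rewrite ltrDl.
Qed.

Lemma L1loc_itv f a b : L1loc f -> leb.-integrable `[a, b] (EFin \o f).
Proof. by move=> lf; apply: L1loc_integrable => //; exact: segment_compact. Qed.

Lemma L1loc_itv_oc f a b : L1loc f -> leb.-integrable `]a, b] (EFin \o f).
Proof.
move=> lf; apply: (integrableS _ _ _ (L1loc_itv a b lf)) => //.
exact: subset_itv_oc_cc.
Qed.

Lemma L1loc_dominated f g : measurable_fun setT f -> L1loc g ->
  (forall x, `|f x| <= g x) -> L1loc f.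
Proof.
move=> mf lg fg; apply: L1locP => // a b.
by apply: integrable_dominated (L1loc_itv a b lg) => //; exact: measurable_funTS.
Qed.

Lemma L1loc_ae f g : L1loc f -> measurable_fun setT g ->
  (\forall x \ae leb, f x = g x) -> L1loc g.
Proof.
move=> [mf oT fK] mg fg; split => // K KT cK.
have mK := compact_measurable cK.
rewrite (_ : (\int[leb]_(x in K) `|g x|%:E = \int[leb]_(x in K) `|f x|%:E)%E).
  exact: fK.
apply: ae_eq_integral => //.
- by apply/measurable_EFinP; apply: measurableT_comp => //; apply: measurable_funTS.
- by apply/measurable_EFinP; apply: measurableT_comp => //; apply: measurable_funTS.
- by apply: ae_mono fg => x -> _.
Qed.

Lemma continuous_bounded_itv f a b : continuous f ->
  exists M, forall x, x \in `[a, b] -> `|f x| <= M.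
Proof.
move=> cf; have /compact_bounded[M [_ fM]] :
    compact (f @` `[a, b]).
  apply: continuous_compact; first exact: continuous_subspaceT.
  exact: segment_compact.
by exists (M + 1) => x xab; apply: fM; [rewrite ltrDl|exists x].
Qed.

Lemma L1loc_mul_continuous f g : L1loc f -> continuous g ->
  L1loc (fun x => f x * g x).
Proof.
move=> lf cg; have mfg : measurable_fun setT (fun x => f x * g x).
  apply: measurable_funM; first exact: L1loc_measurable.
  exact: continuous_measurable_fun.
apply: L1locP => // a b; have [M gM] := continuous_bounded_itv a b cg.
apply: (@integrable_dominated _ _ (fun x => M * `|f x|)) => //.
- exact: measurable_funTS.
- by move=> x xab; rewrite normrM mulrC ler_wpM2r// gM.
- by apply: integrable_scale => //; apply: integrable_norm; exact: L1loc_itv.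
Qed.

Lemma L1loc_continuous f : continuous f -> L1loc f.
Proof.
move=> cf; apply: L1locP; first exact: continuous_measurable_fun.
move=> a b; apply: continuous_compact_integrable; first exact: segment_compact.
exact: continuous_subspaceT.
Qed.

Lemma integrable_mul_support f g a b : L1loc f -> continuous g ->
  (forall x, ~ `[a, b]%classic x -> g x = 0) ->
  leb.-integrable setT (EFin \o (fun x => f x * g x)).
Proof.
move=> lf cg g0; have := L1loc_itv a b (L1loc_mul_continuous lf cg).
move=> /integrable_support; apply=> // x xab.
by rewrite g0// mulr0.
Qed.

Lemma FTC (F f : R -> R) a b : (forall x : R, is_derive x (1 : R) F (f x)) ->
  continuous f -> a <= b -> \int[leb]_(x in `[a, b]) f x = F b - F a.
Proof.
move=> dF cf; rewrite le_eqVlt => /predU1P[->|ab].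
  by rewrite set_itv1 Rintegral_set1 subrr.
have cF : continuous F.
  by apply: derivable_continuous => x; case: (dF x).
rewrite /Rintegral (@continuous_FTC2 _ f F)//.
- exact: continuous_subspaceT.
- split; first by move=> x _; case: (dF x).
  + exact/cvg_at_right_filter/cF.
  + exact/cvg_at_left_filter/cF.
- by move=> x _; rewrite derive1E; case: (dF x).
Qed.

Lemma ae_eq_Rintegral D f g : measurable D -> measurable_fun D f ->
  measurable_fun D g -> (\forall x \ae leb, f x = g x) ->
  \int[leb]_(x in D) f x = \int[leb]_(x in D) g x.
Proof.
move=> mD mf mg fg; congr fine; apply: ae_eq_integral => //.
- exact/measurable_EFinP.
- exact/measurable_EFinP.
- by apply: ae_mono fg => x -> _.
Qed.

End LocallyIntegrable.

(** * Test functions and their supports *)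

Section TestFunctions.
Context {R : realType}.
Implicit Types (phi f : R -> R).

Lemma test_function_continuous phi : test_function phi -> continuous phi.
Proof. by move=> [dphi _]; apply: derivable_continuous => x; exact: (dphi 0%N). Qed.

Lemma test_function_derive1_continuous phi :
  test_function phi -> continuous (derive1 phi).
Proof. by move=> [dphi _]; apply: derivable_continuous => x; exact: (dphi 1%N). Qed.

Lemma test_function_is_derive phi (x : R) : test_function phi ->
  is_derive x (1 : R) phi (derive1 phi x).
Proof. by move=> [dphi _]; rewrite derive1E; apply/derivableP; exact: (dphi 0%N). Qed.

Lemma test_function_support phi : test_function phi ->
  exists M, [/\ 0 <= M,
    forall x, ~ `[- M, M]%classic x -> phi x = 0,
    forall x, ~ `[- M, M]%classic x -> derive1 phi x = 0,
    phi (- M) = 0 & phi M = 0].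
Proof.
move=> [_ /compact_bounded[M [_ KM]]].
have phi0 x : M + 1 < `|x| -> phi x = 0.
  move=> Mx; apply/eqP; apply: contraPT Mx => phix; apply/negP; rewrite -leNgt.
  by apply: KM; [rewrite ltrDl|exact: subset_closure].
have outP (r : R) x : ~ `[- r, r]%classic x -> r < `|x|.
  by rewrite /= in_itv/= -ler_norml ltNge => /negP.
(* The radius is strictly larger than [M + 1], so [phi] vanishes at both endpoints too; the absolute
   value makes it nonnegative. Outside the interval [phi] vanishes on a neighbourhood, hence so does
   its derivative. *)
have M2 : 0 <= `|M| + 2 by rewrite addr_ge0.
have lt2 : M + 1 < `|M| + 2.
  by have := ler_norm M; lra.
exists (`|M| + 2); split => //.
- by move=> x /outP; move=> /(lt_trans lt2); exact: phi0.
- move=> x /outP/(lt_trans lt2) xM.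
  rewrite derive1E -(@near_eq_derive _ _ _ (cst 0) phi x 1) ?derive_cst//.
  near=> y; rewrite phi0//; near: y.
  exact: (cvgr_gt _ (@norm_continuous _ R^o x)).
- by rewrite phi0// normrN ger0_norm.
- by rewrite phi0// ger0_norm.
Unshelve. all: by end_near. Qed.

Lemma smooth_gen_test_function f a b : smooth_gen f ->
  (forall x, ~ `[a, b]%classic x -> f x = 0) -> test_function f.
Proof.
move=> sf f0; split; first exact: smooth_gen_smooth.
apply: (subclosed_compact _ (@segment_compact _ a b)); first exact: closed_closure.
rewrite [X in _ `<=` X](closure_id _).1; last exact: itv_closed.
apply: closureS => x; apply: contraPP => /= /f0 fx.
by rewrite fx eqxx.
Qed.

End TestFunctions.

Section LebesgueLine.
Context {R : realType}.
Local Notation leb := (@lebesgue_measure R).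
Implicit Types (D : set R) (f g : R -> R).

Lemma Rintegral_supp D f :
  (forall x, ~ D x -> f x = 0) -> \int[leb]_(x in D) f x = \int[leb]_x f x.
Proof. by move=> f0; rewrite Rintegral_mkcond restrict_support. Qed.

Lemma integrable_abs D f : leb.-integrable D (EFin \o f) ->
  leb.-integrable D (EFin \o (fun x => `|f x|)).
Proof. exact: integrable_norm. Qed.

(* [R] and [measurableTypeR R] have the same sigma-algebra under different
   displays; [lebesgue_measure] is a measure on the latter. *)
Lemma integrable_sub (D E : set (measurableTypeR R)) f : measurable D -> measurable E ->
  D `<=` E -> leb.-integrable E (EFin \o f) -> leb.-integrable D (EFin \o f).
Proof. by move=> mD mE DE fE; apply: (integrableS _ _ _ fE). Qed.

End LebesgueLine.

Lemma dominated_Rintegral_cvg {R : realType} (D : set (measurableTypeR R))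
    (f_ : nat -> R -> R) (f g : R -> R) :
  measurable D -> (forall n, measurable_fun D (f_ n)) -> measurable_fun D f ->
  (forall x, D x -> f_ n x @[n --> \oo] --> f x) ->
  (@lebesgue_measure R).-integrable D (EFin \o g) ->
  (forall n x, D x -> `|f_ n x| <= g x) ->
  \int[@lebesgue_measure R]_(x in D) f_ n x @[n --> \oo] -->
  \int[@lebesgue_measure R]_(x in D) f x.
Proof.
move=> mD mf_ mf f_f ig f_g; apply: fine_cvg.
have mF_ n : measurable_fun D (EFin \o f_ n) by exact/measurable_EFinP.
have mF : measurable_fun D (EFin \o f) by exact/measurable_EFinP.
have F_F : \forall x \ae @lebesgue_measure R, D x ->
    (EFin \o f_ n) x @[n --> \oo] --> (EFin \o f) x.
  apply: aeW => x Dx; apply/fine_cvgP; split; first exact: nearW.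
  exact: f_f.
have F_g : \forall x \ae @lebesgue_measure R, forall n, D x ->
    (`|(EFin \o f_ n) x| <= (EFin \o g) x)%E.
  by apply: aeW => x n Dx; rewrite lee_fin f_g.
have [fi _] := dominated_convergence mD mF_ mF F_F ig F_g.
rewrite /Rintegral fineK//; exact: integrable_fin_num.
Qed.

(** * Weak derivatives on the line *)

Section WeakDerivative.
Context {R : realType}.
Implicit Types (f g u v w du dv : R -> R) (phi : R -> R).
Local Notation leb := (@lebesgue_measure R).
Local Notation L1loc := (locally_integrable [set: R]).

(** Local integrability is what Lebesgue points and primitives ask for, and the relation in this
    form is stable under products, see [wderivM]. *)
Definition wderiv u du : Prop := [/\ L1loc u, L1loc du &
  forall phi, test_function phi ->
    \int[leb]_x (u x * derive1 phi x) = - \int[leb]_x (du x * phi x)].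

Lemma integrable_mul_test u phi : L1loc u -> test_function phi ->
  leb.-integrable setT (EFin \o (fun x => u x * phi x)).
Proof.
move=> lu tphi; have [M [_ phi0 _ _ _]] := test_function_support tphi.
exact: (integrable_mul_support lu (test_function_continuous tphi) phi0).
Qed.

Lemma integrable_mul_test' u phi : L1loc u -> test_function phi ->
  leb.-integrable setT (EFin \o (fun x => u x * derive1 phi x)).
Proof.
move=> lu tphi; have [M [_ _ phi0 _ _]] := test_function_support tphi.
exact: (integrable_mul_support lu (test_function_derive1_continuous tphi) phi0).
Qed.

(** * Smooth steps, and bumps that concentrate at a point *)

Section Mollifier.
Variables (S s : R -> R) (M : R).
Hypothesis sS : smooth_gen S.
Hypothesis ss : smooth_gen s.
Hypothesis dS : forall x : R, is_derive x (1 : R) S (s x).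
Hypothesis S_le0 : forall x, x <= 0 -> S x = 0 /\ s x = 0.
Hypothesis S_ge1 : forall x, 1 <= x -> S x = 1 /\ s x = 0.
Hypothesis S_01 : forall x, 0 <= S x <= 1.
Hypothesis s_le : forall x, `|s x| <= M.

(** The argument is [(n + 1) * (x - a)], expanded to fit [smooth_gen_affine]. The step rises from 0
    to 1 on [[a, a + 1 / (n + 1)]]. *)
Definition step (a : R) (n : nat) (x : R) : R := S (n.+1%:R * x + - (n.+1%:R * a)).

Definition bump (a : R) (n : nat) (x : R) : R :=
  n.+1%:R * s (n.+1%:R * x + - (n.+1%:R * a)).

Lemma step_smooth a n : smooth_gen (step a n).
Proof. exact: smooth_gen_affine. Qed.

Lemma bump_smooth a n : smooth_gen (bump a n).
Proof.
apply: smooth_genM; first exact: smooth_gen_cst.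
exact: smooth_gen_affine.
Qed.

Lemma is_derive_step a n (x : R) : is_derive x (1 : R) (step a n) (bump a n x).
Proof.
rewrite /bump mulrC.
exact: (is_derive1_comp (dS _) (is_derive_affine _ _ x)).
Qed.

Lemma step_left a n x : x <= a -> step a n x = 0 /\ bump a n x = 0.
Proof.
move=> xa; rewrite /step /bump; have [|-> ->] := @S_le0 (n.+1%:R * x - n.+1%:R * a).
  by rewrite subr_le0 ler_pM2l.
by rewrite mulr0.
Qed.

Lemma step_right a n x : a + n.+1%:R^-1 <= x -> step a n x = 1 /\ bump a n x = 0.
Proof.
move=> xa; rewrite /step /bump; have [|-> ->] := @S_ge1 (n.+1%:R * x - n.+1%:R * a).
  by rewrite -mulrBr mulrC -ler_pdivrMr// mul1r lerBrDl.
by rewrite mulr0.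
Qed.

Lemma bump_support a n x : ~ `[a, a + n.+1%:R^-1]%classic x -> bump a n x = 0.
Proof.
rewrite /= in_itv/= => /negP; rewrite negb_and -!ltNge => /orP[] /ltW x0.
- by case: (step_left n x0).
- by case: (step_right x0).
Qed.

Lemma bump_test a n : test_function (bump a n).
Proof. by apply: smooth_gen_test_function (bump_smooth a n) (@bump_support a n). Qed.

Lemma bump_continuous a n : continuous (bump a n).
Proof. exact: test_function_continuous (bump_test a n). Qed.

Lemma integral_bump a n : \int[leb]_x bump a n x = 1.
Proof.
rewrite -(Rintegral_supp (@bump_support a n)).
rewrite (FTC (is_derive_step a n) (@bump_continuous a n)) ?lerDl//.
by rewrite (step_left n (lexx a)).1 (step_right (lexx _)).1 subr0.
Qed.

Lemma bump_le a n x : `|bump a n x| <= n.+1%:R * M.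
Proof. by rewrite normrM ger0_norm// ler_wpM2l. Qed.

Lemma integrable_mul_bump u a n : L1loc u ->
  leb.-integrable setT (EFin \o (fun x => u x * bump a n x)).
Proof. by move=> lu; exact: integrable_mul_test lu (bump_test a n). Qed.

(** The bumps have mass 1, so the error is the integral of [(u - u a) * bump a n]. It is at most
    [(n + 1) * M] times the integral of [|u - u a|] over a ball of length [4 / (n + 1)], that is,
    [4 * M] times an average which tends to 0 at a Lebesgue point. *)
Lemma bump_cvg u a : L1loc u -> lebesgue_pt u a ->
  (\int[leb]_x (u x * bump a n x)) @[n --> \oo] --> u a.
Proof.
move=> lu ua.
have M0 : 0 <= M by apply: le_trans (s_le 0).
(* Twice the width of the bump, so that the open ball contains the closed support. *)
pose r n : R := 2 * n.+1%:R^-1.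
have r0 n : 0 < r n by rewrite mulr_gt0.
have lc c : L1loc (fun=> c) by apply: L1loc_continuous; exact: cst_continuous.
have luB : L1loc (fun x => u x - u a).
  by apply: (locally_integrableB lu (lc (u a))).
have ball_itv n x : `[a, a + n.+1%:R^-1]%classic x -> ball a (r n) x.
  rewrite /= in_itv/= /ball/= => /andP[ax xa].
  by rewrite distrC ger0_norm ?subr_ge0// ltrBlDl (le_lt_trans xa)//
    ltrD2l /r mulr_natl mulr2n ltrDr.
have cpt n : compact (closed_ball a (r n) : set R).
  exact: closed_ballR_compact.
have iball n : leb.-integrable (ball a (r n)) (EFin \o (fun x => `|u x - u a|)).
  have := integrable_abs (L1loc_integrable luB (cpt n)).
  apply: integrable_sub.
  - exact: measurable_ball.
  - exact: measurable_closed_ball.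
  - exact: subset_closed_ball.
have bound n : `|\int[leb]_x (u x * bump a n x) - u a| <= 4 * M * fine (davg u a (r n)).
  have -> : \int[leb]_x (u x * bump a n x) - u a =
      \int[leb]_x ((u x - u a) * bump a n x).
    rewrite -{1}(mulr1 (u a)) -(integral_bump a n).
    rewrite -RintegralZl//; last first.
      by have := integrable_mul_bump a n (lc 1); under [X in EFin \o X]eq_fun do rewrite mul1r.
    rewrite -RintegralB//.
    - by apply: eq_Rintegral => x _; rewrite mulrBl.
    - exact: integrable_mul_bump.
    - exact: (integrable_mul_bump a n (lc (u a))).
  rewrite (le_trans (le_normr_Rintegral _ (integrable_mul_bump a n luB)))//.
  have sup0 x : ~ ball a (r n) x -> `|(u x - u a) * bump a n x| = 0.
    move=> xB; rewrite bump_support ?mulr0 ?normr0//.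
    by move/ball_itv.
  rewrite -(Rintegral_supp sup0).
  have -> : fine (davg u a (r n)) = (r n *+ 2)^-1 * \int[leb]_(x in ball a (r n)) `|u x - u a|.
    rewrite /davg /iavg lebesgue_measure_ball ?ltW//= inver mulrn_eq0/= gt_eqF//.
    rewrite fineM//=.
    apply: integrable_fin_num; first exact: measurable_ball.
    exact: iball.
  have -> : 4 * M * ((r n *+ 2)^-1 * \int[leb]_(x in ball a (r n)) `|u x - u a|) =
     (n.+1%:R * M) * \int[leb]_(x in ball a (r n)) `|u x - u a|.
    rewrite mulrA; congr (_ * _).
    have : n.+1%:R != 0 :> R by [].
    by rewrite /r; move: (n.+1%:R : R) => N N0; field.
  rewrite -RintegralZl//; last exact: measurable_ball.
  apply: le_Rintegral; first exact: measurable_ball.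
  - apply: (@integrable_sub _ _ setT) => //; first exact: measurable_ball.
    exact: (integrable_abs (integrable_mul_bump a n luB)).
  - by apply: integrable_scale => //; exact: measurable_ball.
  - move=> x _; rewrite normrM mulrC ler_wpM2r//; exact: bump_le.
have [_ davg0] := (fine_cvgP _ _).1 ua.
have r_cvg : r n @[n --> \oo] --> (0 : R).
  by rewrite -(mulr0 2); apply: cvgMl_tmp; exact: cvg_harmonic.
have := (cvg_at_rightP _ _ _).1 davg0 r (conj r0 r_cvg).
move=> /(@cvgMl_tmp _ _ _ _ _ (4 * M) _); rewrite mulr0 => davg0'.
apply/subr_cvg0/cvgr0Pnorm_le => e e0.
move/cvgr0Pnorm_le : davg0' => /(_ e e0); apply: filterS => n; apply: le_trans.
by rewrite (le_trans (bound n))// ler_norm.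
Qed.

(** All the steps vanish at [a] itself, so the limit is the indicator of an open half-line; this is
    why the intervals below are of the form []a, b]]. *)
Lemma step_cvg (a x : R) : step a n x @[n --> \oo] --> ((a < x)%R%:R : R).
Proof.
have [ax|xa] := ltP a x; last first.
  rewrite (_ : (fun n => step a n x) = cst 0); first exact: cvg_cst.
  by apply/funext => n; exact: (step_left n xa).1.
apply: cvg_near_cst; near=> n; apply: (step_right _).1.
rewrite -lerBrDl; near: n.
have := @cvg_harmonic R => /cvgrPdist_le/(_ (x - a)).
rewrite subr_gt0 => /(_ ax); apply: filterS => n.
by rewrite sub0r normrN ger0_norm// invr_ge0.
Unshelve. all: by end_near. Qed.

(** Both steps are 0 to the left of [a] and 1 to the right of [b + 1 / (n + 1)]. The difference is
    written with a factor [-1] to match the closure rules of [smooth_gen]. *)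
Lemma step_test a b n : a <= b ->
  test_function (fun x => step a n x + -1 * step b n x).
Proof.
move=> ab; apply: (@smooth_gen_test_function _ _ a (b + n.+1%:R^-1)).
  apply: smooth_genD; first exact: step_smooth.
  by apply: smooth_genM; [exact: smooth_gen_cst|exact: step_smooth].
move=> x; rewrite /= in_itv/= => /negP; rewrite negb_and -!ltNge => /orP[] /ltW x0.
  by rewrite (step_left n x0).1 (step_left n (le_trans x0 ab)).1 mulr0 addr0.
rewrite (step_right x0).1 (step_right _).1 ?mulr1 ?subrr//.
by rewrite (le_trans _ x0)// lerD2r.
Qed.

Lemma derive1_step_test a b n :
  derive1 (fun x => step a n x + -1 * step b n x) =
  (fun x => bump a n x - bump b n x).
Proof.
apply/funext => x; rewrite derive1E.
have d : is_derive x (1 : R) (fun y => -1 * step b n y) (-1 * bump b n x).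
  exact: is_deriveZ (is_derive_step b n x).
by case: (is_deriveD (is_derive_step a n x) d) => _ ->; rewrite mulN1r.
Qed.

Lemma step_integral_cvg (u : R -> R) a b : L1loc u -> a <= b ->
  \int[leb]_x (u x * (step a n x + -1 * step b n x)) @[n --> \oo] -->
  \int[leb]_(x in `]a, b]) u x.
Proof.
move=> lu ab.
(* Since [1 / (n + 1) <= 1], one interval contains the supports for all [n]; on it [|u|] is the
   dominating function. *)
have sup n x : ~ `[a, b + 1]%classic x ->
    u x * (step a n x + -1 * step b n x) = 0.
  rewrite /= in_itv/= => /negP; rewrite negb_and -!ltNge => /orP[] /ltW x0.
    by rewrite (step_left n x0).1 (step_left n (le_trans x0 ab)).1 mulr0 addr0 mulr0.
  have n1 : n.+1%:R^-1 <= 1 :> R by rewrite invf_le1// ler1n.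
  have xb : b + n.+1%:R^-1 <= x by rewrite (le_trans _ x0)// lerD2l.
  have xa : a + n.+1%:R^-1 <= x by rewrite (le_trans _ xb)// lerD2r.
  by rewrite (step_right xa).1 (step_right xb).1 mulr1 subrr mulr0.
have -> : \int[leb]_(x in `]a, b]) u x =
    \int[leb]_(x in `[a, b + 1]) (u x * \1_`]a, b] x).
  rewrite Rintegral_mkcond [RHS]Rintegral_mkcond; congr (Rintegral _ _ _).
  apply/funext => x; rewrite !patchE indicE.
  case: ifPn => xab; rewrite ?mulr1 ?mulr0; last by rewrite if_same.
  rewrite ifT//; move: xab; rewrite !inE/= !in_itv/=; lra.
rewrite (_ : (fun n => _) = (fun n =>
    \int[leb]_(x in `[a, b + 1]) (u x * (step a n x + -1 * step b n x)))); last first.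
  by apply/funext => n; rewrite -(Rintegral_supp (sup n)).
have mu := L1loc_measurable lu.
apply: (@dominated_Rintegral_cvg _ _ _ _ (fun x => `|u x|)) => //.
- move=> n; apply: measurable_funTS; apply: measurable_funM => //.
  exact: continuous_measurable_fun (test_function_continuous (step_test n ab)).
- apply: measurable_funTS; apply: measurable_funM => //.
- move=> x _; apply: cvgMl_tmp.
  have -> : \1_`]a, b] x = (a < x)%R%:R + -1 * (b < x)%R%:R :> R.
    rewrite indicE mem_setE in_itv/= leNgt; case: (ltP a x) => ax /=.
      by case: (ltP b x) => /=; rewrite ?mulr1 ?subrr ?mulr0 ?addr0.
    by rewrite ltNge (le_trans ax ab)/= mulr0 addr0.
  apply: cvgD; first exact: step_cvg.
  by apply: cvgMl_tmp; exact: step_cvg.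
- exact: (integrable_abs (L1loc_itv _ _ lu)).
- move=> n x _; rewrite normrM -[leRHS]mulr1 ler_wpM2l//.
  have := S_01 (n.+1%:R * x + - (n.+1%:R * a)).
  have := S_01 (n.+1%:R * x + - (n.+1%:R * b)).
  by rewrite -!/(step _ _ _) ler_norml => /andP[? ?] /andP[? ?]; lra.
Qed.

(* The derivative of [step a n - step b n], which tends to the indicator of
   ]a, b], is [bump a n - bump b n], an approximation of the identity at [a]
   minus one at [b]. *)
Lemma wderiv_itv_step u du a b : wderiv u du -> a <= b ->
  lebesgue_pt u a -> lebesgue_pt u b -> \int[leb]_(x in `]a, b]) du x = u b - u a.
Proof.
move=> [lu ldu hu] ab ua ub.
have cdu := step_integral_cvg ldu ab.
have : (- \int[leb]_x (du x * (step a n x + -1 * step b n x))) @[n --> \oo] -->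
    u a - u b.
  rewrite (_ : (fun n => _) = (fun n =>
      \int[leb]_x (u x * bump a n x) - \int[leb]_x (u x * bump b n x))); last first.
    apply/funext => n; rewrite -(hu _ (step_test n ab)) derive1_step_test.
    rewrite -RintegralB//; [|exact: integrable_mul_bump..].
    by apply: eq_Rintegral => x _; rewrite mulrBr.
  by apply: cvgB; exact: bump_cvg.
move=> /(cvg_unique (@Rhausdorff R) (cvgN cdu)) E.
by rewrite -[LHS]opprK E// opprB.
Qed.

Lemma test_orthogonal_eq0_bump w a : L1loc w -> lebesgue_pt w a ->
  (forall phi, test_function phi -> \int[leb]_x (w x * phi x) = 0) -> w a = 0.
Proof.
move=> lw wa w0; have := bump_cvg lw wa.
rewrite (_ : (fun n => _) = cst 0); last first.
  by apply/funext => n; exact: w0 (bump_test a n).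
move=> /(cvg_unique _ (cvg_cst 0)) -> //.
Qed.

End Mollifier.

Lemma wderiv_itv u du a b : wderiv u du -> a <= b ->
  lebesgue_pt u a -> lebesgue_pt u b -> \int[leb]_(x in `]a, b]) du x = u b - u a.
Proof.
have [S [s [M [[sS ss dS] S0 S1 S01 sM]]]] := @smooth_step R.
exact: (@wderiv_itv_step S s M).
Qed.

(** At a Lebesgue point the value of [w] is the limit of its integrals against bumps, all of which
    are zero. This is the fundamental lemma of the calculus of variations. *)
Lemma test_orthogonal_ae_eq0 w : L1loc w ->
  (forall phi, test_function phi -> \int[leb]_x (w x * phi x) = 0) ->
  \forall x \ae leb, w x = 0.
Proof.
have [S [s [M [[sS ss dS] S0 S1 S01 sM]]]] := @smooth_step R.
move=> lw w0; have := lebesgue_differentiation lw; apply: ae_mono => x wx.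
exact: (@test_orthogonal_eq0_bump S s M).
Qed.

Lemma wderiv_unique u du dv : wderiv u du -> wderiv u dv ->
  \forall x \ae leb, du x = dv x.
Proof.
move=> [lu ldu hdu] [_ ldv hdv].
have : \forall x \ae leb, du x - dv x = 0.
  apply: test_orthogonal_ae_eq0; first exact: (locally_integrableB ldu ldv).
  move=> phi tphi; under eq_Rintegral do rewrite mulrBl.
  rewrite RintegralB//; [|exact: integrable_mul_test..].
  by apply/eqP; rewrite subr_eq0 -eqr_opp -hdu// -hdv.
by apply: ae_mono => x /eqP; rewrite subr_eq0 => /eqP.
Qed.

Lemma wderiv_ae u v du dv : wderiv u du ->
  measurable_fun setT v -> measurable_fun setT dv ->
  (\forall x \ae leb, u x = v x) -> (\forall x \ae leb, du x = dv x) ->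
  wderiv v dv.
Proof.
move=> [lu ldu hu] mv mdv uv duv; have lv := L1loc_ae lu mv uv.
have ldv := L1loc_ae ldu mdv duv.
split=> // phi tphi.
have mphi := continuous_measurable_fun (test_function_continuous tphi).
have mphi' := continuous_measurable_fun (test_function_derive1_continuous tphi).
have [mu mdu] := (L1loc_measurable lu, L1loc_measurable ldu).
rewrite -(@ae_eq_Rintegral _ _ (fun x => u x * derive1 phi x)
  (fun x => v x * derive1 phi x))//; first last.
- by apply: ae_mono uv => x ->.
- exact: measurable_funM.
- exact: measurable_funM.
rewrite -(@ae_eq_Rintegral _ _ (fun x => du x * phi x)
  (fun x => dv x * phi x))//; first last.
- by apply: ae_mono duv => x ->.
- exact: measurable_funM.
- exact: measurable_funM.
exact: hu.
Qed.

Lemma wderivD u v du dv : wderiv u du -> wderiv v dv ->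
  wderiv (fun x => u x + v x) (fun x => du x + dv x).
Proof.
move=> [lu ldu hu] [lv ldv hv]; split.
- exact: (locally_integrableD lu lv).
- exact: (locally_integrableD ldu ldv).
move=> phi tphi.
under eq_Rintegral do rewrite mulrDl.
under [in RHS]eq_Rintegral do rewrite mulrDl.
rewrite !RintegralD//; do ?exact: integrable_mul_test; do ?exact: integrable_mul_test'.
by rewrite hu// hv// opprD.
Qed.

Lemma wderivN u du : wderiv u du -> wderiv (fun x => - u x) (fun x => - du x).
Proof.
move=> [lu ldu hu]; split.
- exact: (locally_integrableN lu).
- exact: (locally_integrableN ldu).
move=> phi tphi.
under eq_Rintegral do rewrite mulNr -mulN1r.
under [in RHS]eq_Rintegral do rewrite mulNr -mulN1r.
rewrite !RintegralZl//; do ?exact: integrable_mul_test; do ?exact: integrable_mul_test'.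
by rewrite !mulN1r hu.
Qed.

End WeakDerivative.

(** * Primitives of locally integrable functions, product rule for weak derivatives *)

Section Primitive.
Context {R : realType}.
Implicit Types (F G f g u v du dv : R -> R).
Local Notation leb := (@lebesgue_measure R).
Local Notation L1loc := (locally_integrable [set: R]).

(** Local absolute continuity of [F] with derivative [f], expressed through increments. *)
Definition primitive F f : Prop := L1loc f /\
  forall a b, a <= b -> \int[leb]_(x in `]a, b]) f x = F b - F a.

Lemma primitive_continuous F f : primitive F f -> continuous F.
Proof.
move=> [lf Ff] x.
have ab : x - 1 < x + 1 by lra.
have := parameterized_integral_continuous (ltW ab) (L1loc_itv _ _ lf).
move=> /(continuous_within_itvP _ ab)[c _ _].
have /c cx : x \in `]x - 1, x + 1[ by rewrite in_itv/=; lra.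
have cF : {for x, continuous (fun y => F (x - 1) + parameterized_integral leb (x - 1) y f)}.
  apply: cvgD; [exact: cvg_cst|exact: cx].
apply: (cvg_trans _ (cvg_trans cF _)).
  apply: near_eq_cvg; near=> y.
  rewrite /parameterized_integral -Rintegral_itv_obnd_cbnd.
    rewrite Ff ?subrKC// ltW//; near: y; apply: lt_nbhsr; lra.
  exact: L1loc_itv_oc.
rewrite /= /parameterized_integral -Rintegral_itv_obnd_cbnd.
  rewrite Ff ?subrKC//; lra.
exact: L1loc_itv_oc.
Unshelve. all: by end_near. Qed.

(** A null set cannot contain []0, 1]]. This supplies a Lebesgue point as the base point of a
    primitive. *)
Lemma ae_exists (P : R -> Prop) : (\forall x \ae leb, P x) -> exists x, P x.
Proof.
move=> [A [mA A0 PA]]; apply: contrapT => /forallNP nP.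
have : (leb `]0%R, 1%R]%classic <= leb A)%E.
  by apply: le_measure; rewrite ?inE// => x _; apply: PA; exact: nP.
by rewrite A0 lebesgue_measure_itv/= lte_fin ltr01 oppr0 adde0 lee_fin ler10.
Qed.

Lemma Rintegral_itv_oc_cat f a b c : L1loc f -> a <= b -> b <= c ->
  \int[leb]_(x in `]a, c]) f x =
  \int[leb]_(x in `]a, b]) f x + \int[leb]_(x in `]b, c]) f x.
Proof.
move=> lf ab bc.
rewrite -(@Rintegral_itvB _ _ (BRight a) (BRight c) b) ?bnd_simp//.
  by rewrite subrKC.
exact: L1loc_itv_oc.
Qed.

(** Based at a Lebesgue point [x0] with value [u x0], the primitive coincides with [u] at every
    other Lebesgue point by [wderiv_itv]. The increments over arbitrary intervals then follow from
    additivity, according to the position of [x0]. *)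
Lemma wderiv_primitive u du : wderiv u du ->
  exists2 F, primitive F du & \forall x \ae leb, u x = F x.
Proof.
move=> wu; have [lu ldu _] := wu.
have lpt := lebesgue_differentiation lu; have [x0 lx0] := ae_exists lpt.
pose F x := u x0 + if x0 <= x then \int[leb]_(t in `]x0, x]) du t
  else - \int[leb]_(t in `]x, x0]) du t.
exists F; last first.
  apply: ae_mono lpt => x lx; rewrite /F; case: leP => [|/ltW] x0x.
    by rewrite (wderiv_itv wu x0x lx0 lx) subrKC.
  by rewrite (wderiv_itv wu x0x lx lx0) opprB subrKC.
split => // a b ab; rewrite /F opprD addrACA subrr add0r.
have [x0a|/ltW ax0] := leP x0 a.
  by rewrite (le_trans x0a ab) (Rintegral_itv_oc_cat ldu x0a ab) addrC addKr.
have [x0b|/ltW bx0] := leP x0 b.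
  by rewrite opprK addrC -Rintegral_itv_oc_cat.
by rewrite opprK (Rintegral_itv_oc_cat ldu ab bx0) addrC addrK.
Qed.

Lemma L1loc_scale c f : L1loc f -> L1loc (fun x => c * f x).
Proof.
move=> lf; under eq_fun do rewrite mulrC.
exact: L1loc_mul_continuous lf (@cst_continuous _ _ c).
Qed.

(* Fubini for [f x * g y] on the triangle [a < y <= x <= b]. *)
Lemma primitive_Fubini F G f g a b : primitive F f -> primitive G g -> a <= b ->
  \int[leb]_(x in `]a, b]) (f x * (G x - G a)) =
  \int[leb]_(y in `]a, b]) (g y * (F b - F y)).
Proof.
move=> [lf Ff] [lg Gg] ab.
pose f1 := f \_ `]a, b]; pose g1 := g \_ `]a, b].
have supp f' x : ~ `]a, b]%classic x -> (f' \_ `]a, b]) x = 0 :> R.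
  by move=> xab; rewrite patchE memNset.
have int1 f' c d : L1loc f' -> leb.-integrable setT (EFin \o (f' \_ `]c, d])).
  by move=> lf'; apply: (integrable_restrictT _ (L1loc_itv_oc c d lf')).
have int2 f' c d : L1loc f' -> leb.-integrable setT (EFin \o (f' \_ `[c, d])).
  by move=> lf'; apply: (integrable_restrictT _ (L1loc_itv c d lf')).
have if1 := int1 _ a b lf; have ig1 := int1 _ a b lg.
have mf1 : measurable_fun setT f1 by case/integrableP: if1 => /measurable_EFinP.
have mg1 : measurable_fun setT g1 by case/integrableP: ig1 => /measurable_EFinP.
pose h (z : measurableTypeR R * measurableTypeR R) : R :=
  if z.2 <= z.1 then f1 z.1 * g1 z.2 else 0.
have mh : measurable_fun setT h.
  apply: measurable_fun_ifT.
  - by apply: measurable_fun_ler; [exact: measurable_snd|exact: measurable_fst].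
  - apply: measurable_funM; apply: measurableT_comp => //.
  - exact: measurable_cst.
have ih : (leb \x leb)%E.-integrable setT (EFin \o h).
  have mH : measurable_fun setT (EFin \o h) by exact/measurable_EFinP.
  have mg1' : measurable_fun setT (fun y => `|g1 y|%:E).
    by apply/measurable_EFinP; exact: measurableT_comp.
  have mf1' : measurable_fun setT (fun y => `|f1 y|%:E).
    by apply/measurable_EFinP; exact: measurableT_comp.
  have /integrableP[_ lf1] := if1; have /integrableP[_ lg1] := ig1.
  have Cg0 : (0 <= \int[leb]_y `|g1 y|%:E)%E by exact: integral_ge0.
  apply/(integrable12ltyP leb leb mH).
  (* Dropping the constraint [y <= x] bounds the double integral by the product of the L^1 norms of
     [f1] and [g1]. *)
  apply: (@le_lt_trans _ _ (\int[leb]_x (`|f1 x|%:E * \int[leb]_y `|g1 y|%:E))%E).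
    apply: ge0_le_integral => //.
    - by move=> x _; exact: integral_ge0.
    - have mH' : measurable_fun setT (abse \o (EFin \o h)) by exact: measurableT_comp.
      exact: (measurable_fun_fubini_tonelli_F _ mH' (fun=> abse_ge0 _)).
    - by apply: emeasurable_funM => //; exact: measurable_cst.
    - move=> x _; rewrite -ge0_integralZl//.
      apply: ge0_le_integral => //.
      + apply: measurableT_comp => //.
        exact: (measurableT_comp mH (measurable_pair1 x)).
      + by apply: emeasurable_funM => //; exact: measurable_cst.
      + move=> y _; rewrite /h/= -EFinM lee_fin.
        by case: ifP => _; rewrite ?normrM// normr0 mulr_ge0.
  have Cf0 : (0 <= \int[leb]_y `|f1 y|%:E)%E by exact: integral_ge0.
  rewrite ge0_integralZr//; apply: lte_mul_pinfty => //.
  by rewrite ge0_fin_numE.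
have inner1 x : (\int[leb]_y (h (x, y))%:E)%E =
    (((fun x => f x * (G x - G a)) \_ `]a, b]) x)%:E.
  rewrite patchE; case: ifPn => xab; last first.
    rewrite integral0_eq// => y _; rewrite /h /f1 patchE (negbTE xab) mul0r.
    by rewrite if_same.
  have : x \in `]a, b] by move: xab; rewrite inE.
  rewrite in_itv/= => /andP[ax xb].
  rewrite -Gg ?ltW// -RintegralZl//; last exact: L1loc_itv_oc.
  rewrite Rintegral_mkcond /Rintegral fineK; last first.
    apply: integrable_fin_num => //; apply: (int1 (fun y => f x * g y)).
    exact: L1loc_scale.
  apply: eq_integral => y _; congr EFin; rewrite /h /f1 /g1 !patchE xab/=.
  rewrite !mem_setE !in_itv/=; case: (leP y x) => yx; rewrite ?andbF//.
  rewrite (le_trans yx xb); case: ifP => //; by rewrite mulr0.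
have inner2 y : (\int[leb]_x (h (x, y))%:E)%E =
    (((fun y => g y * (F b - F y)) \_ `]a, b]) y)%:E.
  rewrite patchE; case: ifPn => yab; last first.
    have g1y : g1 y = 0 by rewrite /g1 patchE (negbTE yab).
    by rewrite integral0_eq// => x _; rewrite /h/= g1y mulr0 if_same.
  have : y \in `]a, b] by move: yab; rewrite inE.
  rewrite in_itv/= => /andP[ay yb].
  (* The section of the triangle at height [y] is the closed interval [[y, b]], while increments of
     [F] are integrals over []y, b]]. *)
  rewrite -Ff// Rintegral_itv_obnd_cbnd; last exact: L1loc_itv_oc.
  rewrite -RintegralZl//; last exact: L1loc_itv.
  rewrite Rintegral_mkcond /Rintegral fineK; last first.
    apply: integrable_fin_num => //; apply: (int2 (fun x => g y * f x)).
    exact: L1loc_scale.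
  apply: eq_integral => x _; congr EFin; rewrite /h /f1 /g1 !patchE yab/=.
  rewrite !mem_setE !in_itv/=; case: (leP y x) => yx //=.
  by rewrite (lt_le_trans ay yx)/=; case: ifP => _; rewrite ?mul0r// mulrC.
have := Fubini ih => /=.
under eq_integral do rewrite inner1.
under [in X in _ = X -> _]eq_integral do rewrite inner2.
by move=> E; rewrite Rintegral_mkcond [RHS]Rintegral_mkcond; congr fine.
Qed.

(** Expanding both sides of [primitive_Fubini] leaves the integrals of [f * G] and [F * g], plus
    boundary terms that add up to [F b * G b - F a * G a]. *)
Lemma primitive_mul F G f g : primitive F f -> primitive G g ->
  primitive (fun x => F x * G x) (fun x => F x * g x + f x * G x).
Proof.
move=> pF pG; have [[lf Ff] [lg Gg]] := (pF, pG).
have cF := primitive_continuous pF; have cG := primitive_continuous pG.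
have lFg : L1loc (fun x => F x * g x).
  by under eq_fun do rewrite mulrC; exact: L1loc_mul_continuous.
have lfG := L1loc_mul_continuous lf cG.
split=> [|a b ab]; first exact: (locally_integrableD lFg lfG).
have E := primitive_Fubini pF pG ab.
rewrite RintegralD//; [|exact: L1loc_itv_oc..].
have : \int[leb]_(x in `]a, b]) (f x * (G x - G a)) =
    \int[leb]_(x in `]a, b]) (f x * G x) - (F b - F a) * G a.
  rewrite -Ff// -RintegralZr//; last exact: L1loc_itv_oc.
  rewrite -RintegralB//.
  - by apply: eq_Rintegral => x _; rewrite mulrBr.
  - exact: L1loc_itv_oc.
  - exact: L1loc_itv_oc (L1loc_mul_continuous lf (@cst_continuous _ _ (G a))).
have : \int[leb]_(x in `]a, b]) (g x * (F b - F x)) =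
    (G b - G a) * F b - \int[leb]_(x in `]a, b]) (F x * g x).
  rewrite -Gg// -RintegralZr//; last exact: L1loc_itv_oc.
  rewrite -RintegralB//.
  - by apply: eq_Rintegral => x _; rewrite mulrBr [F x * _]mulrC.
  - exact: L1loc_itv_oc (L1loc_mul_continuous lg (@cst_continuous _ _ (F b))).
  - exact: L1loc_itv_oc.
rewrite E => -> /eqP; rewrite subr_eq => /eqP; lra.
Qed.

Lemma primitive_derive F f : (forall x : R, is_derive x (1 : R) F (f x)) ->
  continuous f -> primitive F f.
Proof.
move=> dF cf; split=> [|a b ab]; first exact: L1loc_continuous.
rewrite Rintegral_itv_obnd_cbnd; first exact: FTC.
by apply: L1loc_itv_oc; exact: L1loc_continuous.
Qed.

(** The product of [F] with a test function is a primitive that vanishes at both ends of an interval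
    containing the support, so the integral of its derivative is zero. *)
Lemma primitive_wderiv F f : primitive F f -> wderiv F f.
Proof.
move=> pF; have [lf _] := pF; have cF := primitive_continuous pF.
have lF := L1loc_continuous cF.
split => // phi tphi.
have pphi : primitive phi (derive1 phi).
  apply: primitive_derive; last exact: test_function_derive1_continuous.
  by move=> x; exact: test_function_is_derive.
have [M [M0 phi0 dphi0 phiN phiM]] := test_function_support tphi.
have [_ /(_ (- M) M)] := primitive_mul pF pphi.
rewrite phiN phiM !mulr0 subrr => /(_ ltac:(lra)).
have supp x : ~ `[- M, M]%classic x -> F x * derive1 phi x + f x * phi x = 0.
  by move=> xM; rewrite phi0// dphi0// !mulr0 addr0.
rewrite Rintegral_itv_obnd_cbnd; last first.
  apply: L1loc_itv_oc; apply: locally_integrableD.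
  - by apply: L1loc_mul_continuous => //; exact: test_function_derive1_continuous.
  - by apply: L1loc_mul_continuous => //; exact: test_function_continuous.
rewrite (Rintegral_supp supp) RintegralD//.
- by move=> /eqP; rewrite addr_eq0 => /eqP.
- exact: integrable_mul_test'.
- exact: integrable_mul_test.
Qed.

Lemma wderivM u v du dv : wderiv u du -> wderiv v dv ->
  wderiv (fun x => u x * v x) (fun x => u x * dv x + du x * v x).
Proof.
move=> wu wv; have [F pF uF] := wderiv_primitive wu.
have [G pG vG] := wderiv_primitive wv.
have [[lu ldu _] [lv ldv _]] := (wu, wv).
have [mu mv] := (L1loc_measurable lu, L1loc_measurable lv).
have [mdu mdv] := (L1loc_measurable ldu, L1loc_measurable ldv).
apply: (wderiv_ae (primitive_wderiv (primitive_mul pF pG))).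
- exact: measurable_funM.
- by apply: measurable_funD; exact: measurable_funM.
- by apply: ae_mono2 uF vG => x -> ->.
- by apply: ae_mono2 uF vG => x -> ->.
Qed.

Lemma wderiv_derive F f : (forall x : R, is_derive x (1 : R) F (f x)) ->
  continuous f -> wderiv F f.
Proof. by move=> dF cf; exact: primitive_wderiv (primitive_derive dF cf). Qed.

End Primitive.

Section IntegralOfDerivative.
Context {R : realType}.
Implicit Types (u du : R -> R).
Local Notation leb := (@lebesgue_measure R).

(* Tested against the cutoffs [S (x / n + 2) - S (x / n - 1)], whose
   derivatives are [O(1 / n)] and which converge to [1]. *)
Lemma integral_wderiv_eq0 u du : wderiv u du ->
  leb.-integrable setT (EFin \o u) -> leb.-integrable setT (EFin \o du) ->
  \int[leb]_x du x = 0.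
Proof.
move=> [lu ldu hu] iu idu.
have [S [s [M [[sS ss dS] S0 S1 S01 sM]]]] := @smooth_step R.
have M0 : 0 <= M by apply: le_trans (sM 0).
have [mu mdu] := (L1loc_measurable lu, L1loc_measurable ldu).
pose k n : R := n.+1%:R^-1.
have k0 n : 0 < k n by rewrite invr_gt0.
(* The first term is 1 as soon as [k n * x >= -1] and the second is 0 as long as [k n * x <= 1];
   both are 0 for [k n * x <= -2] and they cancel for [k n * x >= 2]. *)
pose phi n x := S (k n * x + 2) + -1 * S (k n * x + -1).
pose dphi n x := s (k n * x + 2) * k n + -1 * (s (k n * x + -1) * k n).
have dphiE n (x : R) : is_derive x (1 : R) (phi n) (dphi n x).
  apply: is_deriveD; last apply: is_deriveZ.
    exact: (is_derive1_comp (dS _) (is_derive_affine _ _ x)).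
  exact: (is_derive1_comp (dS _) (is_derive_affine _ _ x)).
have derive1_phi n : derive1 (phi n) = dphi n.
  by apply/funext => x; rewrite derive1E; case: (dphiE n x).
have tphi n : test_function (phi n).
  apply: (@smooth_gen_test_function _ _ (-2 * n.+1%:R) (2 * n.+1%:R)).
    apply: smooth_genD; first exact: smooth_gen_affine.
    by apply: smooth_genM; [exact: smooth_gen_cst|exact: smooth_gen_affine].
  move=> x; rewrite /= in_itv/= => /negP; rewrite negb_and -!ltNge => /orP[] xn.
    have kx : k n * x <= -2.
      by rewrite /k mulrC ler_pdivrMr// ltW.
    by rewrite /phi (S0 _ _).1 ?(S0 (_ + -1) _).1 ?mulr0 ?addr0//; lra.
  have kx : 2 <= k n * x.
    by rewrite /k mulrC ler_pdivlMr// ltW.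
  by rewrite /phi (S1 _ _).1 ?(S1 (_ + -1) _).1 ?mulr1 ?subrr//; lra.
have phi_cvg x : phi n x @[n --> \oo] --> (1 : R).
  apply: cvg_near_cst; near=> n.
  have kx : `|k n * x| <= 1.
    rewrite normrM gtr0_norm// /k mulrC ler_pdivrMr// mul1r.
    apply: (@le_trans _ _ n%:R); last by rewrite ler_nat.
    near: n; exact: nbhs_infty_ger.
  move: kx; rewrite ler_norml => /andP[kx1 kx2].
  by rewrite /phi (S1 _ _).1 ?(S0 _ _).1 ?mulr0 ?addr0//; lra.
have dphi_le n x : `|dphi n x| <= 2 * M * k n.
  rewrite /dphi mulN1r -mulrBl normrM (gtr0_norm (k0 n)) ler_pM2r//.
  rewrite (le_trans (ler_normB _ _))//.
  by have := sM (k n * x + 2); have := sM (k n * x + -1); lra.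
have k1 n : k n <= 1 by rewrite invf_le1// ler1n.
have mphi n := continuous_measurable_fun (test_function_continuous (tphi n)).
have rhs : \int[leb]_x (du x * phi n x) @[n --> \oo] --> \int[leb]_x du x.
  rewrite (_ : \int[leb]_x du x = \int[leb]_x (du x * 1)); last first.
    by apply: eq_Rintegral => x _; rewrite mulr1.
  apply: (@dominated_Rintegral_cvg _ _ _ _ (fun x => `|du x|)) => //.
  - by move=> n; apply: measurable_funM; [exact: mdu|exact: mphi].
  - by apply: measurable_funM; [exact: mdu|exact: measurable_cst].
  - by move=> x _; apply: cvgMl_tmp; exact: phi_cvg.
  - exact: integrable_abs.
  - move=> n x _; rewrite normrM -[leRHS]mulr1 ler_wpM2l//.
    have := S01 (k n * x + 2); have := S01 (k n * x + -1).
    by rewrite ler_norml /phi => /andP[? ?] /andP[? ?]; lra.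
have lhs : \int[leb]_x (u x * derive1 (phi n) x) @[n --> \oo] --> (0 : R).
  rewrite (_ : 0 = \int[leb]_x (cst 0 x)); last by rewrite Rintegral_cst ?mul0r.
  apply: (@dominated_Rintegral_cvg _ _ _ _ (fun x => 2 * M * `|u x|)) => //.
  - move=> n; apply: measurable_funM => //; apply: continuous_measurable_fun.
    exact: test_function_derive1_continuous.
  - move=> x _.
    have b0 : 2 * M * `|u x| * k n @[n --> \oo] --> (0 : R).
      by rewrite -(mulr0 (2 * M * `|u x|)); apply: cvgMl_tmp; exact: cvg_harmonic.
    apply/cvgr0Pnorm_le => e e0.
    move/cvgr0Pnorm_le : b0 => /(_ e e0); apply: filterS => n; apply: le_trans.
    rewrite derive1_phi normrM (le_trans (ler_wpM2l _ (dphi_le n x)))//.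
    by rewrite mulrC mulrAC ler_norm.
  - by apply: integrable_scale => //; exact: integrable_abs.
  - move=> n x _; rewrite normrM mulrC ler_wpM2r// derive1_phi.
    rewrite (le_trans (dphi_le n x))// -[leRHS]mulr1 ler_wpM2l//.
    by rewrite mulr_ge0.
have E : (fun n => \int[leb]_x (u x * derive1 (phi n) x)) =
    (fun n => - \int[leb]_x (du x * phi n x)) by apply/funext => n; exact: hu.
rewrite E in lhs; have {}E := cvg_unique (@Rhausdorff R) (cvgN rhs) lhs.
by rewrite -[LHS]opprK E oppr0.
Unshelve. all: by end_near. Qed.
End IntegralOfDerivative.

(** * Integration against mu *)

Section Density.
Context d (T : measurableType d) (R : realType).
Variables (m m' : {measure set T -> \bar R}) (w : T -> R).
Hypothesis w_ge0 : forall x, 0 <= w x.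
Hypothesis mw : measurable_fun setT w.
Hypothesis m'E : forall A, measurable A -> m' A = (\int[m]_(x in A) (w x)%:E)%E.
Import HBNNSimple.
Local Open Scope ereal_scope.

Let mW : measurable_fun setT (EFin \o w).
Proof. exact/measurable_EFinP. Qed.

Let integral_density_indic (A : set T) : measurable A ->
  \int[m']_x (\1_A x)%:E = \int[m]_x ((\1_A x)%:E * (w x)%:E).
Proof.
move=> mA; rewrite integral_indic// setIT m'E// integral_mkcond.
apply: eq_integral => x _; rewrite patchE indicE.
by case: ifP => _; rewrite ?mul1e ?mul0e.
Qed.

Let integral_density_nnsfun (f : {nnsfun T >-> R}) :
  \int[m']_x (f x)%:E = \int[m]_x ((f x)%:E * (w x)%:E).
Proof.
under [LHS]eq_integral do rewrite fimfunE -fsumEFin//.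
rewrite [LHS]ge0_integral_fsum//; last 2 first.
  - by move=> r; exact/measurable_EFinP/measurableT_comp.
  - by move=> n x _; rewrite EFinM nnfun_muleindic_ge0.
under [RHS]eq_integral.
  move=> x xD; rewrite fimfunE -fsumEFin// ge0_mule_fsuml; last first.
    by move=> r; rewrite EFinM nnfun_muleindic_ge0.
  over.
rewrite [RHS]ge0_integral_fsum//; last 2 first.
  - move=> r; apply: emeasurable_funM => //.
    exact/measurable_EFinP/measurableT_comp.
  - by move=> n x _; rewrite EFinM mule_ge0//; [exact: nnfun_muleindic_ge0|rewrite lee_fin].
apply: eq_fsbigr => r; rewrite inE => -[t _ ft].
have r0 : (0 <= r)%R by rewrite -ft.
rewrite integralZl_indic_nnsfun// integral_density_indic//.
under [RHS]eq_integral do rewrite EFinM -muleA.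
rewrite ge0_integralZl//.
- apply: emeasurable_funM => //.
  exact/measurable_EFinP/measurable_indic.
- by move=> x _; rewrite mule_ge0 ?lee_fin.
Qed.

(** On indicators this is the hypothesis on [m']; it extends by linearity to simple functions and by
    monotone convergence to nonnegative ones. *)
Lemma ge0_integral_density (f : T -> \bar R) : measurable_fun setT f ->
  (forall x, 0 <= f x) -> \int[m']_x f x = \int[m]_x (f x * (w x)%:E).
Proof.
move=> mf f0; pose f_ := nnsfun_approx measurableT mf.
transitivity (limn (fun n => \int[m']_x (f_ n x)%:E)).
  rewrite -monotone_convergence//=.
  - apply: eq_integral => x _; apply/esym/cvg_lim => //=.
    exact: cvg_nnsfun_approx.
  - by move=> n; exact/measurable_EFinP/measurable_funTS.
  - by move=> n x _; rewrite lee_fin.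
  - by move=> x _ a b ab; rewrite lee_fin; exact/lefP/nd_nnsfun_approx.
transitivity (limn (fun n => \int[m]_x ((f_ n x)%:E * (w x)%:E))).
  by apply: congr_lim; apply/funext => n; exact: integral_density_nnsfun.
rewrite -monotone_convergence//=.
- apply: eq_integral => x _; apply/cvg_lim => //=.
  apply: cvgeMr; first by [].
  exact: cvg_nnsfun_approx.
- move=> n; apply: emeasurable_funM => //.
  exact/measurable_EFinP/measurable_funTS.
- by move=> n x _; rewrite mule_ge0 ?lee_fin.
- move=> x _ a b ab; rewrite lee_wpmul2r ?lee_fin//; exact/lefP/nd_nnsfun_approx.
Qed.

End Density.

Section MuIntegral.
Context {R : realType} (U : R -> R).
Hypothesis mU : measurable_fun setT U.
Local Notation leb := (@lebesgue_measure R).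
Local Open Scope ereal_scope.

Let w (x : R) : R := expR (- U x).

Let mw : measurable_fun setT w.
Proof. by apply: measurableT_comp => //; exact: measurableT_comp. Qed.

Let nu0 : nu U set0 = 0.
Proof. by rewrite /nu integral_set0. Qed.

Let nu_ge0 A : 0 <= nu U A.
Proof. by apply: integral_ge0 => x _; rewrite lee_fin expR_ge0. Qed.

(** [nu U] and [mu U] are plain set functions. Packed as measures, they give access to the
    integration theory, and the integrals against either form are convertible. *)
Let nuM : {measure set (measurableTypeR R) -> \bar R} :=
  HB.pack (nu U : set (measurableTypeR R) -> \bar R)
    (isMeasure.Build _ _ _ (nu U : set (measurableTypeR R) -> \bar R)
       nu0 nu_ge0 (nu_semi_sigma_additive mU)).

Let mu0 : mu U set0 = 0.
Proof. by rewrite /mu big1// => t _; exact: nu0. Qed.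

Let mu_ge0 A : 0 <= mu U A.
Proof. by apply: sume_ge0 => t _; exact: nu_ge0. Qed.

Let muM : {measure set (R * bool) -> \bar R} :=
  HB.pack (mu U : set (R * bool) -> \bar R)
    (isMeasure.Build _ _ _ (mu U : set (R * bool) -> \bar R)
       mu0 mu_ge0 (mu_semi_sigma_additive mU)).

Let slice (t : bool) : {mfun measurableTypeR R >-> (R * bool)%type} :=
  HB.pack (fun x : measurableTypeR R => (x, t))
    (isMeasurableFun.Build _ _ _ _ _
      (@pair2_measurable _ _ R bool t :
        measurable_fun [set: measurableTypeR R]
          (fun x : measurableTypeR R => (x, t) : R * bool))).

(** [mu U] is the sum of the images of [nu U] under the two embeddings [x |-> (x, t)], and [nu U]
    has density [w] with respect to Lebesgue measure. *)
Lemma ge0_integral_mu (F : R * bool -> \bar R) : measurable_fun setT F ->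
  (forall z, 0 <= F z) ->
  \int[mu U]_z F z = \int[leb]_x (F (x, true) * (w x)%:E) +
    \int[leb]_x (F (x, false) * (w x)%:E).
Proof.
move=> mF F0; rewrite -[LHS]/(\int[muM]_z F z).
rewrite (eq_measure_integral (measure_add (pushforward nuM (slice true))
  (pushforward nuM (slice false)))); last first.
  move=> A mA _; apply/esym; apply: (eq_trans (measure_addE _ _ _)).
  by rewrite /= /mu big_bool.
rewrite ge0_integral_measure_add//.
have E t : \int[pushforward nuM (slice t)]_z F z = \int[leb]_x (F (x, t) * (w x)%:E).
  rewrite ge0_integral_pushforward//=.
  apply: (@ge0_integral_density _ _ _ leb nuM w) => //.
  - by move=> x; exact: expR_ge0.
  - exact: (measurableT_comp mF (pair2_measurable t)).
by rewrite !E.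
Qed.

End MuIntegral.

(** * Complex-valued functions *)

Section ComplexParts.
Context {R : realType}.
Implicit Types (z v : R[i]) (a : R).
Local Notation re := complex.Re.
Local Notation im := complex.Im.

Definition normc2 z : R := Normc.normc z ^+ 2.

Lemma normc2E z : normc2 z = re z ^+ 2 + im z ^+ 2.
Proof. by case: z => a b; rewrite /normc2/= sqr_sqrtr// addr_ge0 ?sqr_ge0. Qed.

Lemma normc2_ge0 z : 0 <= normc2 z. Proof. exact: sqr_ge0. Qed.

Lemma cReD z v : re (z + v) = re z + re v. Proof. by case: z v => ? ? []. Qed.
Lemma cImD z v : im (z + v) = im z + im v. Proof. by case: z v => ? ? []. Qed.
Lemma cReN z : re (- z) = - re z. Proof. by case: z. Qed.
Lemma cImN z : im (- z) = - im z. Proof. by case: z. Qed.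
Lemma cReM z v : re (z * v) = re z * re v - im z * im v.
Proof. by case: z v => ? ? []. Qed.
Lemma cImM z v : im (z * v) = re z * im v + im z * re v.
Proof. by case: z v => ? ? []. Qed.
Lemma cReJ z : re z^* = re z. Proof. by case: z. Qed.
Lemma cImJ z : im z^* = - im z. Proof. by case: z. Qed.
Lemma cRe0 : re (0 : R[i]) = 0. Proof. by []. Qed.
Lemma cIm0 : im (0 : R[i]) = 0. Proof. by []. Qed.
Lemma cReR a : re a%:C%C = a. Proof. by []. Qed.
Lemma cImR a : im a%:C%C = 0. Proof. by []. Qed.
Lemma complex_ext z v : re z = re v -> im z = im v -> z = v.
Proof. by case: z v => ? ? [] ? ? /= -> ->. Qed.

Definition partsE := (cReD, cImD, cReN, cImN, cReM, cImM, cReJ, cImJ, cReR, cImR,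
  cRe0, cIm0).

Lemma complexP z v : z = v <-> re z = re v /\ im z = im v.
Proof. by split=> [->//|[]]; exact: complex_ext. Qed.

Lemma normc2J z : normc2 z^* = normc2 z.
Proof. by rewrite !normc2E !partsE sqrrN. Qed.

Lemma normc2_scale z a : normc2 (z * a%:C%C) = normc2 z * a ^+ 2.
Proof. by rewrite !normc2E !partsE; ring. Qed.

Lemma normc2D z v : normc2 (z + v) <= 2 * normc2 z + 2 * normc2 v.
Proof.
rewrite !normc2E !partsE.
have := sqr_ge0 (re z - re v); have := sqr_ge0 (im z - im v); lra.
Qed.

(** A consequence of [(|a| - 1) ^+ 2 >= 0]. It gives the inclusion of L^2_loc in L^1_loc by plain
    domination. *)
Lemma norm_cRe_le z : `|re z| <= 1 + normc2 z.
Proof.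
rewrite normc2E; have := sqr_ge0 (im z); have := sqr_ge0 (`|re z| - 1).
rewrite sqrrB real_normK ?num_real//; have := normr_ge0 (re z); lra.
Qed.

Lemma norm_cIm_le z : `|im z| <= 1 + normc2 z.
Proof.
rewrite normc2E; have := sqr_ge0 (re z); have := sqr_ge0 (`|im z| - 1).
rewrite sqrrB real_normK ?num_real//; have := normr_ge0 (im z); lra.
Qed.

(** A pointwise Young inequality, by which the integrand of [inner] is dominated. *)
Lemma norm_cReM_le z v : `|re (z * v^*)| <= normc2 z + normc2 v.
Proof.
rewrite !normc2E !partsE ler_norml.
have := sqr_ge0 (re z - re v); have := sqr_ge0 (im z - im v).
have := sqr_ge0 (re z + re v); have := sqr_ge0 (im z + im v).
have := sqr_ge0 (re z); have := sqr_ge0 (im z).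
have := sqr_ge0 (re v); have := sqr_ge0 (im v); lra.
Qed.

Lemma norm_cImM_le z v : `|im (z * v^*)| <= normc2 z + normc2 v.
Proof.
rewrite !normc2E !partsE ler_norml.
have := sqr_ge0 (re z - im v); have := sqr_ge0 (im z - re v).
have := sqr_ge0 (re z + im v); have := sqr_ge0 (im z + re v).
have := sqr_ge0 (re z); have := sqr_ge0 (im z).
have := sqr_ge0 (re v); have := sqr_ge0 (im v); lra.
Qed.

End ComplexParts.

Section ComplexMeasurable.
Context {R : realType} d (T : measurableType d).
Implicit Types (f g : T -> R[i]) (a : T -> R).

Lemma cmeasurableD f g : cmeasurable f -> cmeasurable g ->
  cmeasurable (fun x => f x + g x).
Proof.
move=> [fr fi] [gr gi]; split.
- by under eq_fun do rewrite cReD; exact: measurable_funD.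
- by under eq_fun do rewrite cImD; exact: measurable_funD.
Qed.

Lemma cmeasurableM f g : cmeasurable f -> cmeasurable g ->
  cmeasurable (fun x => f x * g x).
Proof.
move=> [fr fi] [gr gi]; split.
- by under eq_fun do rewrite cReM; apply: measurable_funB; exact: measurable_funM.
- by under eq_fun do rewrite cImM; apply: measurable_funD; exact: measurable_funM.
Qed.

Lemma cmeasurableR a : measurable_fun setT a -> cmeasurable (fun x => (a x)%:C%C).
Proof. by move=> ma; split; [exact: ma|exact: measurable_cst]. Qed.

Lemma cmeasurableN f : cmeasurable f -> cmeasurable (fun x => - f x).
Proof.
move=> [fr fi]; split.
- by under eq_fun do rewrite cReN; exact: measurableT_comp.
- by under eq_fun do rewrite cImN; exact: measurableT_comp.
Qed.

Lemma cmeasurableB f g : cmeasurable f -> cmeasurable g ->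
  cmeasurable (fun x => f x - g x).
Proof. by move=> mf mg; apply: cmeasurableD => //; exact: cmeasurableN. Qed.

Lemma cmeasurable_conj f : cmeasurable f -> cmeasurable (fun x => (f x)^*).
Proof.
move=> [fr fi]; split.
- by under eq_fun do rewrite cReJ.
- by under eq_fun do rewrite cImJ; exact: measurableT_comp.
Qed.

Lemma measurable_normc2 f : cmeasurable f -> measurable_fun setT (fun x => normc2 (f x)).
Proof.
move=> [fr fi]; under eq_fun do rewrite normc2E.
by apply: measurable_funD; exact: measurable_funX.
Qed.

End ComplexMeasurable.

Section ComplexLine.
Context {R : realType}.
Implicit Types (f g df dg : R -> R[i]) (a : R -> R).
Local Notation leb := (@lebesgue_measure R).
Local Notation L1loc := (locally_integrable [set: R]).
Local Notation re := complex.Re.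
Local Notation im := complex.Im.

Lemma L1loc_cst (c : R) : L1loc (fun=> c).
Proof. by apply: L1loc_continuous; exact: cst_continuous. Qed.

Lemma L2locP f : L2loc f <-> cmeasurable f /\ L1loc (fun x => normc2 (f x)).
Proof.
have E K : (\int[leb]_(x in K) `|normc2 (f x)|%:E =
    \int[leb]_(x in K) (Normc.normc (f x) ^+ 2)%:E)%E.
  by apply: eq_integral => x _; rewrite ger0_norm ?normc2_ge0.
split=> [[mf fK]|[mf [_ _ fK]]]; split => //.
  by split=> [||K _ cK]; [exact: measurable_normc2|exact: openT|rewrite E; exact: fK].
by move=> K cK; rewrite -E; exact: fK.
Qed.

Lemma L2loc_L1loc_re f : L2loc f -> L1loc (fun x => re (f x)).
Proof.
move=> /L2locP[[mf _] lf].
apply: (@L1loc_dominated _ _ (fun x => 1 + normc2 (f x))) => //.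
  exact: (locally_integrableD (L1loc_cst 1) lf).
by move=> x; exact: norm_cRe_le.
Qed.

Lemma L2loc_L1loc_im f : L2loc f -> L1loc (fun x => im (f x)).
Proof.
move=> /L2locP[[_ mf] lf].
apply: (@L1loc_dominated _ _ (fun x => 1 + normc2 (f x))) => //.
  exact: (locally_integrableD (L1loc_cst 1) lf).
by move=> x; exact: norm_cIm_le.
Qed.

Lemma L2locD f g : L2loc f -> L2loc g -> L2loc (fun x => f x + g x).
Proof.
move=> /L2locP[mf lf] /L2locP[mg lg]; apply/L2locP; split.
  exact: cmeasurableD.
apply: (@L1loc_dominated _ _ (fun x => 2 * normc2 (f x) + 2 * normc2 (g x))).
- exact/measurable_normc2/cmeasurableD.
- by apply: locally_integrableD; exact: L1loc_scale.
- by move=> x; rewrite ger0_norm ?normc2_ge0//; exact: normc2D.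
Qed.

Lemma L2loc_mul_continuous f a : L2loc f -> continuous a ->
  L2loc (fun x => f x * (a x)%:C%C).
Proof.
move=> /L2locP[mf lf] ca; apply/L2locP; split.
  exact: (cmeasurableM mf (cmeasurableR (continuous_measurable_fun ca))).
under eq_fun do rewrite normc2_scale.
apply: L1loc_mul_continuous => // x.
by exact: (cvgM (ca x) (ca x)).
Qed.

Lemma L2loc_conj f : L2loc f -> L2loc (fun x => (f x)^*).
Proof.
move=> /L2locP[mf lf]; apply/L2locP; split; first exact: cmeasurable_conj.
by under eq_fun do rewrite normc2J.
Qed.

Lemma L2loc_continuous a : continuous a -> L2loc (fun x => (a x)%:C%C).
Proof.
move=> ca; apply/L2locP; split.
  exact: (cmeasurableR (continuous_measurable_fun ca)).
under eq_fun do rewrite normc2E cReR cImR expr0n addr0.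
by apply: L1loc_continuous => x; exact: (cvgM (ca x) (ca x)).
Qed.

Definition cwderiv f df : Prop :=
  wderiv (fun x => re (f x)) (fun x => re (df x)) /\
  wderiv (fun x => im (f x)) (fun x => im (df x)).

Lemma cwderivD f g df dg : cwderiv f df -> cwderiv g dg ->
  cwderiv (fun x => f x + g x) (fun x => df x + dg x).
Proof.
move=> [fr fi] [gr gi]; split.
- by under eq_fun do rewrite cReD;
  under [X in wderiv _ X]eq_fun do rewrite cReD; exact: wderivD.
- by under eq_fun do rewrite cImD;
  under [X in wderiv _ X]eq_fun do rewrite cImD; exact: wderivD.
Qed.

Lemma cwderivM f g df dg : cwderiv f df -> cwderiv g dg ->
  cwderiv (fun x => f x * g x) (fun x => f x * dg x + df x * g x).
Proof.
move=> [fr fi] [gr gi]; split.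
- have := wderivD (wderivM fr gr) (wderivN (wderivM fi gi)).
  congr wderiv; apply/funext => x; rewrite !partsE//; ring.
- have := wderivD (wderivM fr gi) (wderivM fi gr).
  congr wderiv; apply/funext => x; rewrite !partsE//; ring.
Qed.

Lemma cwderiv_conj f df : cwderiv f df ->
  cwderiv (fun x => (f x)^*) (fun x => (df x)^*).
Proof.
move=> [fr fi]; split.
- by under eq_fun do rewrite cReJ; under [X in wderiv _ X]eq_fun do rewrite cReJ.
- by under eq_fun do rewrite cImJ;
  under [X in wderiv _ X]eq_fun do rewrite cImJ; exact: wderivN.
Qed.

Lemma cwderivR (F a : R -> R) : (forall x : R, is_derive x (1 : R) F (a x)) ->
  continuous a -> cwderiv (fun x => (F x)%:C%C) (fun x => (a x)%:C%C).
Proof.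
move=> dF ca; split; first exact: wderiv_derive.
by apply: wderiv_derive => [x|]; [exact: is_derive_cst|exact: cst_continuous].
Qed.

Lemma cwderiv_cst (c : R) : cwderiv (fun=> c%:C%C) (fun=> 0).
Proof. by apply: (@cwderivR (cst c) (cst 0)); exact: cst_continuous. Qed.

Lemma cintegral_scale f a : cintegral (fun x => f x * (a x)%:C%C) =
  (\int[leb]_x (re (f x) * a x) +i* \int[leb]_x (im (f x) * a x))%C.
Proof.
by congr Complex; apply: eq_Rintegral => x _; rewrite !partsE mulr0 ?subr0 ?add0r.
Qed.

(** Test functions are real, so the defining identity splits into its real and imaginary parts. *)
Lemma is_weak_derivativeP f df : L2loc f -> L2loc df ->
  is_weak_derivative f df <-> cwderiv f df.
Proof.
move=> lf ldf; split=> [h|[hr hi] phi tphi].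
  split; (split; [exact: L2loc_L1loc_re||exact: L2loc_L1loc_im|
    exact: L2loc_L1loc_re||exact: L2loc_L1loc_im|]) => phi tphi;
  by have := h phi tphi; rewrite !cintegral_scale => -[].
rewrite !cintegral_scale; apply: complex_ext => /=.
- by case: hr => _ _; exact.
- by case: hi => _ _; exact.
Qed.

Lemma W12loc_weak_derivative f : W12loc f ->
  L2loc (weak_derivative f) /\ cwderiv f (weak_derivative f).
Proof.
move=> [lf [g lg fg]].
have [ld dd] : L2loc (weak_derivative f) /\ is_weak_derivative f (weak_derivative f).
  rewrite /weak_derivative; case: xgetP => [_ _ //|/(_ g)]; case.
  by split.
by split => //; apply/is_weak_derivativeP.
Qed.

(** The choice made by [weak_derivative] is arbitrary; uniqueness of weak derivatives identifies it
    up to a null set. *)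
Lemma cwderiv_weak_derivative f df : L2loc f -> L2loc df -> cwderiv f df ->
  W12loc f /\ \forall x \ae leb, weak_derivative f x = df x.
Proof.
move=> lf ldf fdf.
have wf : W12loc f by split => //; exists df => //; exact/is_weak_derivativeP.
split => //; have [lw [wr wi]] := W12loc_weak_derivative wf.
have [dr di] := fdf.
by apply: ae_mono2 (wderiv_unique wr dr) (wderiv_unique wi di) => x; exact: complex_ext.
Qed.

Definition cintegrable f : Prop := leb.-integrable setT (EFin \o (fun x => re (f x))) /\
  leb.-integrable setT (EFin \o (fun x => im (f x))).

Lemma cintegrableD f g : cintegrable f -> cintegrable g ->
  cintegrable (fun x => f x + g x).
Proof.
move=> [fr fi] [gr gi]; split.
- by have := integrableD measurableT fr gr;
  apply: eq_integrable => // x _; rewrite /= cReD EFinD.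
- by have := integrableD measurableT fi gi;
  apply: eq_integrable => // x _; rewrite /= cImD EFinD.
Qed.

Lemma cintegrableN f : cintegrable f -> cintegrable (fun x => - f x).
Proof.
move=> [fr fi]; split.
- by have := integrableN fr; apply: eq_integrable => // x _; rewrite /= cReN EFinN.
- by have := integrableN fi; apply: eq_integrable => // x _; rewrite /= cImN EFinN.
Qed.

Lemma cintegralD f g : cintegrable f -> cintegrable g ->
  cintegral (fun x => f x + g x) = cintegral f + cintegral g.
Proof.
move=> [fr fi] [gr gi]; apply: complex_ext; rewrite !partsE/= -RintegralD//.
- by apply: eq_Rintegral => x _; rewrite partsE.
- by apply: eq_Rintegral => x _; rewrite partsE.
Qed.

Lemma cintegralN f : cintegrable f -> cintegral (fun x => - f x) = - cintegral f.
Proof.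
move=> [fr fi]; apply: complex_ext; rewrite !partsE/= -mulN1r -RintegralZl//.
- by apply: eq_Rintegral => x _; rewrite partsE mulN1r.
- by apply: eq_Rintegral => x _; rewrite partsE mulN1r.
Qed.

Lemma ae_eq_cintegral f g : cmeasurable f -> cmeasurable g ->
  (\forall x \ae leb, f x = g x) -> cintegral f = cintegral g.
Proof.
move=> [fr fi] [gr gi] fg; congr Complex; apply: ae_eq_Rintegral => //.
- by apply: ae_mono fg => x ->.
- by apply: ae_mono fg => x ->.
Qed.

Lemma cintegral_cwderiv_eq0 f df : cwderiv f df -> cintegrable f -> cintegrable df ->
  cintegral df = 0.
Proof.
move=> [wr wi] [fr fi] [dr di]; apply: complex_ext; rewrite partsE/=.
- exact: integral_wderiv_eq0 wr fr dr.
- exact: integral_wderiv_eq0 wi fi di.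
Qed.

End ComplexLine.

(** * The space L^2(mu) in terms of the two copies of the line *)

Section L2Slices.
Context {R : realType} (U : R -> R).
Hypothesis cU : continuous U.
Implicit Types (f g h : E R -> R[i]) (t : bool).
Local Notation leb := (@lebesgue_measure R).
Local Notation L1loc := (locally_integrable [set: R]).
Local Notation re := complex.Re.
Local Notation im := complex.Im.
Local Notation w := (fun x : R => expR (- U x)).

Lemma weight_continuous : continuous w.
Proof.
move=> x; apply: (@continuous_comp _ _ _ (fun y => - U y) expR).
  by apply: continuousN; exact: cU.
exact: continuous_expR.
Qed.

Lemma measurable_slices (F : R * bool -> R) :
  measurable_fun setT F <-> forall t, measurable_fun setT (fun x => F (x, t)).
Proof.
split=> [mF t|mF]; first exact: (measurableT_comp mF (pair2_measurable t)).
rewrite (_ : F = fun z => if z.2 then F (z.1, true) else F (z.1, false)).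
  apply: measurable_fun_ifT; first exact: measurable_snd.
  - exact: (measurableT_comp (mF true) measurable_fst).
  - exact: (measurableT_comp (mF false) measurable_fst).
by apply/funext => -[x []].
Qed.

Lemma cmeasurable_slices f : @cmeasurable R _ (R * bool)%type f <->
  forall t, cmeasurable (fun x => f (x, t)).
Proof.
split=> [[/measurable_slices mr /measurable_slices mi] t|mf]; first by split.
by split; apply/measurable_slices => t; case: (mf t).
Qed.

Let mU : measurable_fun setT U. Proof. exact: continuous_measurable_fun. Qed.

Let mw : measurable_fun setT w.
Proof. exact: continuous_measurable_fun weight_continuous. Qed.

Lemma L2P f : L2 U f <-> forall t, cmeasurable (fun x => f (x, t)) /\
  leb.-integrable setT (EFin \o (fun x => normc2 (f (x, t)) * w x)).
Proof.
have intE (mf : @cmeasurable R _ (R * bool)%type f) :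
    (\int[mu U]_e (Normc.normc (f e) ^+ 2)%:E =
    \int[leb]_x (normc2 (f (x, true)) * w x)%:E +
    \int[leb]_x (normc2 (f (x, false)) * w x)%:E)%E.
  rewrite (ge0_integral_mu mU)//.
  - by apply/measurable_EFinP; exact: measurable_normc2 mf.
  - by move=> z; rewrite lee_fin sqr_ge0.
have ge0 t : (0 <= \int[leb]_x (normc2 (f (x, t)) * w x)%:E)%E.
  by apply: integral_ge0 => x _; rewrite lee_fin mulr_ge0 ?normc2_ge0 ?expR_ge0.
have m2 t : cmeasurable (fun x => f (x, t)) ->
    measurable_fun setT (fun x => normc2 (f (x, t)) * w x).
  by move=> mf; apply: measurable_funM => //; exact: measurable_normc2.
have intP t : cmeasurable (fun x => f (x, t)) ->
    leb.-integrable setT (EFin \o (fun x => normc2 (f (x, t)) * w x)) <->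
    (\int[leb]_x (normc2 (f (x, t)) * w x)%:E < +oo)%E.
  move=> mf; have E : (\int[leb]_x `|(normc2 (f (x, t)) * w x)%:E| =
      \int[leb]_x (normc2 (f (x, t)) * w x)%:E)%E.
    by apply: eq_integral => x _; rewrite gee0_abs// lee_fin mulr_ge0 ?normc2_ge0 ?expR_ge0.
  split; first by move=> /integrableP[_]; rewrite E.
  move=> fin; apply/integrableP; split; last by rewrite E.
  by apply/measurable_EFinP; exact: m2.
split=> [[mf fin] t|h].
  have mft := (cmeasurable_slices f).1 mf; split => //.
  apply/intP => //; rewrite (intE mf) in fin; apply: le_lt_trans fin.
  by case: t; [rewrite leeDl|rewrite leeDr].
have mf : @cmeasurable R _ (R * bool)%type f.
  by apply/cmeasurable_slices => t; case: (h t).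
split => //; rewrite (intE mf); apply: lte_add_pinfty.
- by apply/intP; case: (h true).
- by apply/intP; case: (h false).
Qed.

(** The density vanishes nowhere, so a null integral over [A] forces [A] to be Lebesgue null. *)
Lemma nu_eq0 (A : set R) : measurable A -> nu U A = 0%E <-> leb A = 0%E.
Proof.
move=> mA.
have mwA : measurable_fun A (EFin \o w) by apply/measurable_EFinP; exact: measurable_funTS.
split=> [A0|A0]; last by rewrite /nu; exact: null_set_integral.
have /(ae_eq_integral_abs leb mA mwA) : (\int[leb]_(x in A) `|(EFin \o w) x| = 0)%E.
  by rewrite -[RHS]A0; apply: eq_integral => x _; rewrite gee0_abs// lee_fin expR_ge0.
move=> [B [mB B0 AB]]; apply/eqP; rewrite eq_le measure_ge0 andbT -B0.
apply: le_measure; rewrite ?inE// => x Ax; apply: AB => /(_ Ax)/eqP.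
by rewrite eqe expR_eq0.
Qed.

Lemma L2_eqP f g : L2_eq U f g <->
  forall t, \forall x \ae leb, f (x, t) = g (x, t).
Proof.
split=> [[A [mA A0 fgA]] t|fg].
  have mAt : measurable [set x | A (x, t)].
    by rewrite -[X in measurable X]setTI; exact: (pair2_measurable t).
  exists [set x | A (x, t)]; split => //; last by move=> x /= fgx; exact: fgA.
  apply/nu_eq0 => //; move: A0; rewrite /mu big_bool/=.
  have nu_ge0 B : (0 <= nu U B)%E.
    by apply: integral_ge0 => x _; rewrite lee_fin expR_ge0.
  by move/eqP; rewrite padde_eq0// => /andP[/eqP ? /eqP ?]; case: t mAt.
have [A [mA A0 fgA]] := fg true; have [B [mB B0 fgB]] := fg false.
exists (A `*` [set true] `|` B `*` [set false]); split.
- by apply: measurableU; exact: measurableX.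
- rewrite /mu big_bool/= (_ : [set x | _] = A); last first.
    by apply/seteqP; split=> x /=; [case=> -[]|left].
  rewrite (_ : [set x | _] = B); last first.
    by apply/seteqP; split=> x /=; [case=> -[]|right].
  by rewrite !(nu_eq0 _).2// adde0.
- by move=> [x []] /= fgx; [left; split => //; exact: fgA|right; split => //; exact: fgB].
Qed.

Lemma L2_cmeasurable f t : L2 U f -> cmeasurable (fun x => f (x, t)).
Proof. by move=> /L2P/(_ t)[]. Qed.

(** Multiplying the integrable function [normc2 f * w] by the continuous function [exp (U)] removes
    the weight and keeps local integrability. *)
Lemma L2_L2loc f t : L2 U f -> L2loc (fun x => f (x, t)).
Proof.
move=> /L2P/(_ t)[mf fi]; apply/L2locP; split => //.
have ceU : continuous (fun x => expR (U x)).
  move=> x; apply: (@continuous_comp _ _ _ U expR); first exact: cU.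
  exact: continuous_expR.
have := L1loc_mul_continuous (open_integrable_locally openT fi) ceU.
congr (locally_integrable _ _); apply/funext => x.
by rewrite -mulrA -expRD addNr expR0 mulr1.
Qed.

Lemma L2_ae f g : L2 U f -> (forall t, cmeasurable (fun x => g (x, t))) ->
  (forall t, \forall x \ae leb, f (x, t) = g (x, t)) -> L2 U g.
Proof.
move=> /L2P Lf mg fg; apply/L2P => t; split => //; have [mf fi] := Lf t.
have mfw : measurable_fun setT (fun x => normc2 (f (x, t)) * w x).
  by apply: measurable_funM => //; exact: measurable_normc2.
have mgw : measurable_fun setT (fun x => normc2 (g (x, t)) * w x).
  by apply: measurable_funM => //; exact: measurable_normc2.
apply/integrableP; split; first exact/measurable_EFinP.
have /integrableP[_] := fi; congr (_ < _)%E; apply: ae_eq_integral => //.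
- by apply: measurableT_comp => //; exact/measurable_EFinP.
- by apply: measurableT_comp => //; exact/measurable_EFinP.
- by apply: ae_mono (fg t) => x /= ->.
Qed.

Lemma L2_compact_support (Psi : bool -> R -> R) (M : R) :
  (forall t, continuous (Psi t)) ->
  (forall t x, ~ `[- M, M]%classic x -> Psi t x = 0) ->
  L2 U (fun '(x, t) => (Psi t x)%:C%C).
Proof.
move=> cPsi Psi0; apply/L2P => t; split.
  exact: (cmeasurableR (continuous_measurable_fun (cPsi t))).
have lw : L1loc w by exact: L1loc_continuous weight_continuous.
(* The square is split as [(w * Psi) * Psi]: the first factor is locally integrable, the second
   brings the compact support. *)
have := integrable_mul_support (L1loc_mul_continuous lw (cPsi t)) (cPsi t) (Psi0 t).
apply: eq_integrable => // x _ /=.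
by rewrite normc2E !partsE expr0n addr0 expr2 -mulrA mulrC.
Qed.

Lemma inner_cintegrable f g t : L2 U f -> L2 U g ->
  cintegrable (fun x => f (x, t) * (g (x, t))^* * (w x)%:C%C).
Proof.
move=> /L2P/(_ t)[mf fi] /L2P/(_ t)[mg gi].
have mfgw : cmeasurable (fun x => f (x, t) * (g (x, t))^* * (w x)%:C%C).
  apply: cmeasurableM; last exact: cmeasurableR.
  by apply: cmeasurableM => //; exact: cmeasurable_conj.
have isum := integrableD measurableT fi gi.
split.
- apply: (integrable_dominated _ mfgw.1 _ isum) => // x _.
  rewrite cReM cReR cImR mulr0 subr0 normrM [`|w x|]ger0_norm ?expR_ge0//.
  by rewrite -mulrDl ler_wpM2r ?expR_ge0// norm_cReM_le.
- apply: (integrable_dominated _ mfgw.2 _ isum) => // x _.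
  rewrite cImM cReR cImR mulr0 add0r normrM [`|w x|]ger0_norm ?expR_ge0//.
  by rewrite -mulrDl ler_wpM2r ?expR_ge0// norm_cImM_le.
Qed.

Lemma inner_ae f f' g g' : L2 U f -> L2 U f' -> L2 U g -> L2 U g' ->
  (forall t, \forall x \ae leb, f (x, t) = f' (x, t)) ->
  (forall t, \forall x \ae leb, g (x, t) = g' (x, t)) ->
  inner U f g = inner U f' g'.
Proof.
have cm h k t : L2 U h -> L2 U k ->
    cmeasurable (fun x => h (x, t) * (k (x, t))^* * (w x)%:C%C).
  move=> Lh Lk; apply: cmeasurableM; last exact: cmeasurableR.
  by apply: cmeasurableM; [exact: L2_cmeasurable|exact/cmeasurable_conj/L2_cmeasurable].
move=> Lf Lf' Lg Lg' ff gg; apply: eq_bigr => t _.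
by apply: ae_eq_cintegral; [exact: cm..|apply: ae_mono2 (ff t) (gg t) => x -> ->].
Qed.

End L2Slices.

(** * The adjoint of the zigzag operator *)

Lemma conj_real (R : realType) (a : R) : (a%:C%C)^* = a%:C%C.
Proof. by apply: complex_ext; rewrite ?cReJ ?cImJ //= oppr0. Qed.

Lemma cintegral0 (R : realType) : cintegral (fun _ : R => 0) = 0.
Proof. by apply: complex_ext; rewrite /= Rintegral_cst ?mul0r. Qed.

Section ZigzagAdjoint.
Context {R : realType} (U lref : R -> R).
Hypothesis dU : forall x : R, derivable U x 1.
Hypothesis cdU : continuous (derive1 U).
Hypothesis clref : continuous lref.
Implicit Types (f g h : E R -> R[i]) (t : bool).
Local Notation leb := (@lebesgue_measure R).
Local Notation L1loc := (locally_integrable [set: R]).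
Local Notation re := complex.Re.
Local Notation im := complex.Im.
Local Notation w := (fun x : R => expR (- U x)).
Local Notation lam := (rate U lref).

Let cU : continuous U. Proof. exact: derivable_continuous. Qed.

Let dU' (x : R) : is_derive x (1 : R) U (derive1 U x).
Proof. by rewrite derive1E; exact/derivableP. Qed.

Lemma cwderiv_weight :
  cwderiv (fun x => (w x)%:C%C) (fun x => (w x * - derive1 U x)%:C%C).
Proof.
apply: cwderivR => x.
  exact: (is_derive1_comp (is_derive_expR _) (is_deriveN (dU' x))).
by apply: cvgM; [exact: weight_continuous|apply: cvgN; exact: cdU].
Qed.

Lemma cwderiv_weightV :
  cwderiv (fun x => (expR (U x))%:C%C) (fun x => (expR (U x) * derive1 U x)%:C%C).
Proof.
apply: cwderivR => x.
  exact: (is_derive1_comp (is_derive_expR _) (dU' x)).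
apply: cvgM; last exact: cdU.
by apply: (@continuous_comp _ _ _ U expR); [exact: cU|exact: continuous_expR].
Qed.

Lemma rate_continuous t : continuous (lam ^~ t).
Proof.
move=> x; apply: cvgD; last exact: clref.
apply: (@continuous_max _ _ (fun y => theta_val t * derive1 U y) (cst 0)).
  by apply: cvgM; [exact: cvg_cst|exact: cdU].
exact: cvg_cst.
Qed.

(** [max (y, 0) - max (- y, 0) = y], and the refreshment rate cancels. In this form the derivative
    of the weight is traded against the switching rates. *)
Lemma rate_sub x : lam x true - lam x false = derive1 U x.
Proof.
rewrite /rate /theta_val mul1r mulN1r opprD addrACA subrr addr0.
by rewrite /Order.max; case: ifPn; case: ifPn; rewrite -?leNgt; lra.
Qed.

Lemma cmeasurable_rate t : cmeasurable (fun x => (lam x t)%:C%C).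
Proof.
apply: cmeasurableR; apply: continuous_measurable_fun.
exact: rate_continuous.
Qed.

Lemma W12loc_E_cmeasurable f t : W12loc_E f -> cmeasurable (fun x => partial_x f (x, t)).
Proof. by move=> /(_ t)/W12loc_weak_derivative[/L2locP[]]. Qed.

Lemma cmeasurable_zigzag f t : L2 U f -> W12loc_E f ->
  cmeasurable (fun x => zigzag_formula U lref f (x, t)).
Proof.
move=> Lf Wf; apply: cmeasurableD; apply: cmeasurableM.
- by apply: cmeasurableR; exact: measurable_cst.
- exact: W12loc_E_cmeasurable.
- exact: cmeasurable_rate.
- exact: (cmeasurableB (L2_cmeasurable cU _ Lf) (L2_cmeasurable cU _ Lf)).
Qed.

Lemma cmeasurable_zigzag_times f t : L2 U f -> W12loc_E f ->
  cmeasurable (fun x => zigzag_times_formula U lref f (x, t)).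
Proof.
move=> Lf Wf; apply: cmeasurableD; apply: cmeasurableM.
- by apply: cmeasurableN; apply: cmeasurableR; exact: measurable_cst.
- exact: W12loc_E_cmeasurable.
- exact: cmeasurable_rate.
- exact: (cmeasurableB (L2_cmeasurable cU _ Lf) (L2_cmeasurable cU _ Lf)).
Qed.

(* Green's identity: the difference of the two integrands is the derivative of
   the flux [sum_theta theta * f * g^* * exp (- U)], which is integrable. *)
Lemma zigzag_green f g : dom (zigzag U lref) f -> dom (zigzag_times U lref) g ->
  inner U (zigzag_formula U lref f) g = inner U f (zigzag_times_formula U lref g).
Proof.
move=> [Lf Wf Lzf] [Lg Wg Lzg].
pose I h k t x := h (x, t) * (k (x, t))^* * (w x)%:C%C : R[i].
have iI h k t : L2 U h -> L2 U k -> cintegrable (I h k t).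
  by move=> Lh Lk; exact: inner_cintegrable.
pose P x := I f g true x + - I f g false x.
pose Lf' := zigzag_formula U lref f; pose Lg' := zigzag_times_formula U lref g.
pose D x := (I Lf' g true x + I Lf' g false x) +
  - (I f Lg' true x + I f Lg' false x).
have iP : cintegrable P by apply: cintegrableD; [|apply: cintegrableN]; exact: iI.
have iD1 : cintegrable (fun x => I Lf' g true x + I Lf' g false x).
  by apply: cintegrableD; exact: iI.
have iD2 : cintegrable (fun x => I f Lg' true x + I f Lg' false x).
  by apply: cintegrableD; exact: iI.
have iD : cintegrable D by apply: cintegrableD => //; exact: cintegrableN.
have PD : cwderiv P D.
  have dI t := cwderivM (cwderivM (W12loc_weak_derivative (Wf t)).2
    (cwderiv_conj (W12loc_weak_derivative (Wg t)).2)) cwderiv_weight.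
  have := cwderivD (dI true) (cwderivM (cwderiv_cst (-1)) (dI false)).
  congr cwderiv; apply/funext => x.
    by rewrite /P rmorphN rmorph1 mulN1r.
  (* Once [U'] is replaced by the difference of the rates, the two derivatives agree as polynomials
     in the rates, the weight, and the values and weak derivatives of [f] and conj(g). *)
  rewrite -rate_sub /D /I /Lf' /Lg' /zigzag_formula /zigzag_times_formula.
  rewrite /theta_val /partial_x /=.
  by rewrite !(rmorphD, rmorphM, rmorphN, rmorph1)/= !conj_real; ring.
have := cintegral_cwderiv_eq0 PD iP iD.
rewrite /D cintegralD//; last exact: cintegrableN.
rewrite cintegralN// !cintegralD//; do ?exact: iI.
by rewrite /inner !big_bool => /eqP; rewrite subr_eq0 => /eqP.
Qed.

Definition lift_test t (phi : R -> R) : E R -> R[i] :=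
  fun '(x, s) => (if s == t then phi x else 0)%:C%C.

(** The continuous representative of [L] applied to [lift_test t phi], with a classical derivative
    in place of the chosen weak one. On the copy [~~ t] it reduces to the jump term
    [lam x (~~ t) * phi x]. *)
Definition zigzag_lift_test t (phi : R -> R) (s : bool) (x : R) : R :=
  theta_val s * (if s == t then derive1 phi x else 0) +
  lam x s * ((if ~~ s == t then phi x else 0) - (if s == t then phi x else 0)).

Lemma zigzag_lift_test_dom t phi : test_function phi ->
  [/\ dom (zigzag U lref) (lift_test t phi),
      L2 U (fun '(x, s) => (zigzag_lift_test t phi s x)%:C%C) &
      forall s, \forall x \ae leb, zigzag_formula U lref (lift_test t phi) (x, s) =
        (zigzag_lift_test t phi s x)%:C%C].
Proof.
move=> tphi.
have [M [M0 phi0 dphi0 _ _]] := test_function_support tphi.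
have cphi := test_function_continuous tphi.
have cdphi := test_function_derive1_continuous tphi.
pose Phi s x : R := if s == t then phi x else 0.
pose dPhi s x : R := if s == t then derive1 phi x else 0.
have cPhi s : continuous (Phi s).
  by rewrite /Phi; case: eqP => _; [exact: cphi|exact: cst_continuous].
have cdPhi s : continuous (dPhi s).
  by rewrite /dPhi; case: eqP => _; [exact: cdphi|exact: cst_continuous].
have dPhiE s (x : R) : is_derive x (1 : R) (Phi s) (dPhi s x).
  rewrite /Phi /dPhi; case: eqP => _; first exact: test_function_is_derive.
  exact: is_derive_cst.
have Lphi : L2 U (lift_test t phi).
  apply: (@L2_compact_support _ _ cU Phi M) => // s x xM.
  by rewrite /Phi phi0// if_same.
have Lz : L2 U (fun '(x, s) => (zigzag_lift_test t phi s x)%:C%C).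
  apply: (@L2_compact_support _ _ cU _ M) => [s|s x xM].
    move=> x; apply: cvgD.
      by apply: cvgM; [exact: cvg_cst|exact: cdPhi].
    apply: cvgM; first exact: rate_continuous.
    by apply: cvgB; exact: cPhi.
  by rewrite /zigzag_lift_test phi0// dphi0// !if_same subrr !mulr0 addr0.
have W s : W12loc (fun x => lift_test t phi (x, s)) /\
    \forall x \ae leb, weak_derivative (fun x => lift_test t phi (x, s)) x = (dPhi s x)%:C%C.
  apply: cwderiv_weak_derivative.
  - exact: (L2_L2loc cU s Lphi).
  - exact: (L2loc_continuous (cdPhi s)).
  - exact: (cwderivR (dPhiE s) (cdPhi s)).
have zE s : \forall x \ae leb, zigzag_formula U lref (lift_test t phi) (x, s) =
        (zigzag_lift_test t phi s x)%:C%C.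
  apply: ae_mono (W s).2 => x E; rewrite /zigzag_formula /partial_x E.
  by rewrite /lift_test /zigzag_lift_test /dPhi !(rmorphD, rmorphM, rmorphN)/=.
split => //; split => //; first by move=> s; case: (W s).
apply: L2_ae Lz _ _ => //.
- by move=> s; apply: cmeasurable_zigzag => // s'; case: (W s').
- by move=> s; apply: ae_mono (zE s) => x ->.
Qed.

(** [al] and [ga] stand for the real or the imaginary parts of conj(g) e^-U and conj(h) e^-U, and
    the hypothesis for the adjoint equation tested on the copy [t]. The only term with [phi'] is
    [theta * al t * phi']; solving for it uses [theta ^+ 2 = 1]. *)
Lemma wderiv_adjoint (al ga : bool -> R -> R) t :
  (forall s, L1loc (al s)) -> (forall s, L1loc (ga s)) ->
  (forall phi, test_function phi ->
    \int[leb]_x (al true x * zigzag_lift_test t phi true x) +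
    \int[leb]_x (al false x * zigzag_lift_test t phi false x) =
    \int[leb]_x (ga t x * phi x)) ->
  wderiv (al t) (fun x => - theta_val t *
    (lam x t * al t x - lam x (~~ t) * al (~~ t) x + ga t x)).
Proof.
move=> la lg H.
have lr s s' : L1loc (fun x => lam x s * al s' x).
  under eq_fun do rewrite mulrC.
  by apply: L1loc_mul_continuous (la s') _; exact: rate_continuous.
have lK : L1loc (fun x => lam x t * al t x - lam x (~~ t) * al (~~ t) x + ga t x).
  exact: (locally_integrableD (locally_integrableB (lr _ _) (lr _ _)) (lg _)).
split; [exact: la|exact: L1loc_scale|move=> phi tphi].
have i1 s s' : leb.-integrable setT (EFin \o (fun x => lam x s * al s' x * phi x)).
  exact: integrable_mul_test.
have i2 : leb.-integrable setT (EFin \o (fun x => ga t x * phi x)).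
  exact: integrable_mul_test.
have i3 : leb.-integrable setT (EFin \o (fun x => al t x * derive1 phi x)).
  exact: integrable_mul_test'.
have i4 : leb.-integrable setT (EFin \o (fun x =>
    (lam x t * al t x - lam x (~~ t) * al (~~ t) x + ga t x) * phi x)).
  exact: integrable_mul_test.
under [in RHS]eq_Rintegral do rewrite -mulrA.
rewrite RintegralZl//.
have E1 : \int[leb]_x (al t x * zigzag_lift_test t phi t x) =
    theta_val t * \int[leb]_x (al t x * derive1 phi x) -
    \int[leb]_x (lam x t * al t x * phi x).
  rewrite -RintegralZl// -RintegralB//; last by apply: integrable_scale.
  apply: eq_Rintegral => x _; rewrite /zigzag_lift_test eqxx.
  by case: t {H lK i2 i3 i4} => /=; ring.
have E2 : \int[leb]_x (al (~~ t) x * zigzag_lift_test t phi (~~ t) x) =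
    \int[leb]_x (lam x (~~ t) * al (~~ t) x * phi x).
  apply: eq_Rintegral => x _; rewrite /zigzag_lift_test.
  by case: t {H lK i2 i3 i4 E1} => /=; ring.
have E3 : \int[leb]_x ((lam x t * al t x - lam x (~~ t) * al (~~ t) x + ga t x) * phi x) =
    \int[leb]_x (lam x t * al t x * phi x) -
    \int[leb]_x (lam x (~~ t) * al (~~ t) x * phi x) + \int[leb]_x (ga t x * phi x).
  rewrite -RintegralB// -RintegralD//; last first.
    have := integrableB measurableT (i1 t t) (i1 (~~ t) (~~ t)).
    by apply: eq_integrable => // x _; rewrite /= EFinB.
  by apply: eq_Rintegral => x _; ring.
rewrite E3 -(H _ tphi).
by case: t {H lK i2 i3 i4 E3} E1 E2 => /= -> ->; rewrite /theta_val; ring.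
Qed.

Lemma adjoint_graph_zigzag_times g h : adjoint_graph U (zigzag U lref) g h ->
  W12loc_E g /\
  forall t, \forall x \ae leb, zigzag_times_formula U lref g (x, t) = h (x, t).
Proof.
move=> [Lg Lh adj].
pose a s x : R[i] := (g (x, s))^* * (w x)%:C%C.
pose c s x : R[i] := (h (x, s))^* * (w x)%:C%C.
have cw := weight_continuous cU.
have la s : L2loc (a s).
  by apply: L2loc_mul_continuous cw; exact: (L2loc_conj (L2_L2loc cU s Lg)).
have lc s : L2loc (c s).
  by apply: L2loc_mul_continuous cw; exact: (L2loc_conj (L2_L2loc cU s Lh)).
have key t phi : test_function phi ->
    cintegral (fun x => a true x * (zigzag_lift_test t phi true x)%:C%C) +
    cintegral (fun x => a false x * (zigzag_lift_test t phi false x)%:C%C) =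
    cintegral (fun x => c t x * (phi x)%:C%C).
  move=> tphi; have [df Lz zE] := zigzag_lift_test_dom t tphi.
  have [Lf Wf Lzf] := df.
  (* The chosen weak derivative is exchanged for the classical one under the inner product, where
     null sets do not matter. *)
  have := adj _ df; rewrite (@inner_ae _ _ cU (zigzag_formula U lref (lift_test t phi))
    (fun '(x, s) => (zigzag_lift_test t phi s x)%:C%C) g g) //; last first.
    by move=> s; exact: aeW.
  rewrite /inner !big_bool /= => E.
  transitivity (\sum_(s : bool) cintegral (fun x =>
      lift_test t phi (x, s) * (h (x, s))^* * (w x)%:C%C)).
    rewrite big_bool [RHS]/= -E; congr (cintegral _ + cintegral _); apply/funext => x.
      by rewrite /a mulrC mulrA.
    by rewrite /a mulrC mulrA.
  rewrite (bigD1 t)//= [X in _ + X]big1 ?addr0 => [|s /negbTE st]; last first.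
    rewrite -[RHS]cintegral0; congr cintegral; apply/funext => x.
    by rewrite st rmorph0 !mul0r.
  congr cintegral; apply/funext => x.
  by rewrite eqxx /c [RHS]mulrC mulrA.
pose K t x : R[i] := (- theta_val t)%:C%C *
  ((lam x t)%:C%C * a t x - (lam x (~~ t))%:C%C * a (~~ t) x + c t x).
have aK t : cwderiv (a t) (K t).
  split.
  - have := @wderiv_adjoint (fun s x => re (a s x)) (fun s x => re (c s x)) t
      (fun s => L2loc_L1loc_re (la s)) (fun s => L2loc_L1loc_re (lc s)).
    rewrite (_ : (fun x => - theta_val t * _) = (fun x => re (K t x))); last first.
      by apply/funext => x; rewrite /K !partsE; ring.
    apply=> phi tphi; have := key t phi tphi.
    by rewrite !cintegral_scale => /complexP[].
  - have := @wderiv_adjoint (fun s x => im (a s x)) (fun s x => im (c s x)) t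
      (fun s => L2loc_L1loc_im (la s)) (fun s => L2loc_L1loc_im (lc s)).
    rewrite (_ : (fun x => - theta_val t * _) = (fun x => im (K t x))); last first.
      by apply/funext => x; rewrite /K !partsE; ring.
    apply=> phi tphi; have := key t phi tphi.
    by rewrite !cintegral_scale => /complexP[].
(* The derivative of [g = conj (a * exp (U))] given by the product rule, with the exponentials
   already cancelled: each summand is visibly an L^2_loc function times a continuous one. *)
pose G t x : R[i] := g (x, t) * (derive1 U x - theta_val t * lam x t)%:C%C +
  g (x, ~~ t) * (theta_val t * lam x (~~ t))%:C%C + h (x, t) * (- theta_val t)%:C%C.
have lG t : L2loc (G t).
  have cl s : continuous (fun x => theta_val t * lam x s).
    by move=> x; apply: cvgM; [exact: cvg_cst|exact: rate_continuous].
  apply: L2locD; first apply: L2locD; apply: L2loc_mul_continuous.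
  - exact: (L2_L2loc cU t Lg).
  - by move=> x; apply: cvgB; [exact: cdU|exact: cl].
  - exact: (L2_L2loc cU (~~ t) Lg).
  - exact: cl.
  - exact: (L2_L2loc cU t Lh).
  - exact: cst_continuous.
have gG t : cwderiv (fun x => g (x, t)) (G t).
  have := cwderiv_conj (cwderivM (aK t) cwderiv_weightV).
  have e0 x : (expR (U x))%:C%C != 0 by rewrite fmorph_eq0 gt_eqF ?expR_gt0.
  congr cwderiv; apply/funext => x; move: (e0 x).
    rewrite /a expRN fmorphV !(rmorphM, fmorphV)/= conjCK !conj_real => {}e0.
    by rewrite mulfVK.
  rewrite /K /G /a /c expRN !(rmorphD, rmorphM, rmorphN, fmorphV)/= !conjCK !conj_real.
  by move=> {}e0; field.
have gW t := cwderiv_weak_derivative (L2_L2loc cU t Lg) (lG t) (gG t).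
split=> [t|t]; first by case: (gW t).
apply: ae_mono (gW t).2 => x E; rewrite /zigzag_times_formula /partial_x E.
(* Here [U' - theta * lam x t = - theta * lam x (~~ t)], so [- theta * G] equals [h] minus the jump
   term of [L^x g]. *)
rewrite /G -rate_sub /theta_val !(rmorphD, rmorphM, rmorphN)/=.
by case: t {E} => /=; rewrite ?rmorphN rmorph1; ring.
Qed.

End ZigzagAdjoint.

Theorem lemma3p4 (R : realType) (U lref : R -> R)
  (U_derivable : forall x : R, derivable U x 1)
  (U'_continuous : continuous (derive1 U))
  (lref_continuous : continuous lref)
  (lref_ge0 : forall x : R, 0 <= lref x) :
  adjoint_dom U (zigzag U lref) = dom (zigzag_times U lref) /\
  (forall g h : E R -> R[i],
     adjoint_graph U (zigzag U lref) g h <-> graph U (zigzag_times U lref) g h).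
Proof.
have cU : continuous U by exact: derivable_continuous.
have graphP g h :
    adjoint_graph U (zigzag U lref) g h <-> graph U (zigzag_times U lref) g h.
  split=> [adj|[dg Lh gh]].
    have [Lg Lh _] := adj.
    have [Wg gh] := adjoint_graph_zigzag_times U_derivable U'_continuous
      lref_continuous adj.
    split => //; last exact/(L2_eqP cU).
    (* [L^x g] belongs to L^2(mu) because it agrees almost everywhere with [h]. *)
    split => //; apply: (L2_ae cU Lh) => t.
      exact: cmeasurable_zigzag_times.
    by apply: ae_mono (gh t) => x ->.
  have [Lg Wg Lzg] := dg; split => // f df; have [Lf Wf Lzf] := df.
  rewrite zigzag_green//; apply: inner_ae => //.
    by move=> t; exact: aeW.
  exact/(L2_eqP cU).
split => //; apply/seteqP; split=> [g [h /graphP[]]//|g dg].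
(* For [g] in D(L^x), the function [L^x g] itself serves as a value of the adjoint at [g]. *)
exists (zigzag_times_formula U lref g); apply/graphP; split => //; first by case: dg.
by apply/(L2_eqP cU) => t; exact: aeW.
Qed.
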